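(* Let $(M,\mathsf{M})$ be a $C^r$-manifold, $U,V\subset M$ open subsets with $M=U\cup V$, and $W=U\cap V$. The correspondence $\mathsf{A}=\{(U,\phi),(V,\psi)\}\mapsto g_{\mathsf{A}}=\psi\circ\phi^{-1}|_W$, associating to each $(U,V)$-atlas $\mathsf{A}$ on $M$ its transition map $g_{\mathsf{A}}\in\mathcal{D}(W)$, yields an injective map $\mu'$ - from the set $\mathfrak{C}^r(M,\mathsf{U},\mathsf{V})/\mathcal{H}(M,U,V)$ of all $C^r$-structures on $M$ induced by some $(U,V)$-atlas, up to a $C^r$-diffeomorphism leaving $U$ and $V$ invariant, - to the set $\mathcal{E}_V(W)\setminus\mathcal{D}(W)/\mathcal{E}_U(W)$ of $(\mathcal{E}_V(W),\mathcal{E}_U(W))$-double cosets. Moreover, $\mu'$ is a bijection if and only if every $g\in\mathcal{D}(W)$ is the transition map of some $(U,V)$-atlas on $M$.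
   Context: Fix $r\in\{1,2,\ldots,\infty\}$. Manifolds are topological spaces locally homeomorphic to open subsets of cones $K=\{x\in P: f_1(x)\ge0,\ldots,f_k(x)\ge0\}$ with non-empty interior, where $P$ is a finite-dimensional real vector space and the $f_i$ are linear; they are not assumed Hausdorff or second countable. A map between open subsets of cones is $C^r$ if it extends to a $C^r$-map between open subsets of the ambient Euclidean spaces. A $C^r$-atlas is a family of charts (open embeddings of open subsets into cones) with domains covering the space and $C^r$-diffeomorphic transition maps; a $C^r$-structure is a maximal $C^r$-atlas; a $C^r$-manifold is a manifold with a fixed $C^r$-atlas. Let $\mathsf{U},\mathsf{V},\mathsf{W}$ be the restrictions of the atlas $\mathsf{M}$ to $U,V,W$ (each chart is restricted to the intersection of its domain with the given open set). A $(U,V)$-atlas on $M$ is a pair $\mathsf{A}=\{\phi:U\to U,\ \psi:V\to V\}$ of homeomorphisms with $\phi(W)=W=\psi(W)$ such that the transition map $g_{\mathsf{A}}=\psi\circ\phi^{-1}|_W:(W,\mathsf{W})\to(W,\mathsf{W})$ is a $C^r$-diffeomorphism. It induces a $C^r$-atlas $\mathsf{Q}_{\mathsf{A}}$ on $M$ consisting of all charts $(\phi^{-1}(O),\kappa\circ\phi)$, $(O,\kappa)\in\mathsf{U}$, and $(\psi^{-1}(O),\kappa\circ\psi)$, $(O,\kappa)\in\mathsf{V}$. Let $\mathfrak{C}^r(M,\mathsf{U},\mathsf{V})$ be the set of all $C^r$-structures on $M$ containing $\mathsf{Q}_{\mathsf{A}}$ for some $(U,V)$-atlas $\mathsf{A}$.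 $\mathcal{H}(M,U,V)$ is the group of homeomorphisms $h:M\to M$ with $h(U)=U$, $h(V)=V$. Two structures define the same element of $\mathfrak{C}^r(M,\mathsf{U},\mathsf{V})/\mathcal{H}(M,U,V)$ iff some $h\in\mathcal{H}(M,U,V)$ is a $C^r$-diffeomorphism from $M$ with the first structure to $M$ with the second. $\mathcal{D}(W)$ is the group of $C^r$-diffeomorphisms of $(W,\mathsf{W})$. $\mathcal{E}_U(W)\subset\mathcal{D}(W)$ (resp. $\mathcal{E}_V(W)\subset\mathcal{D}(W)$) is the subgroup of all restrictions to $W$ of $C^r$-diffeomorphisms of $(U,\mathsf{U})$ (resp. of $(V,\mathsf{V})$) that map $W$ onto $W$. The set $\mathcal{E}_V(W)\setminus\mathcal{D}(W)/\mathcal{E}_U(W)$ is the orbit set of the action of $\mathcal{E}_V(W)\times\mathcal{E}_U(W)$ on $\mathcal{D}(W)$ given by $(b,a)\cdot g=b\circ g\circ a^{-1}$. *)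

(* Defs.v *)
From HB Require Import structures.
From mathcomp Require Import all_boot all_order all_algebra.
From mathcomp Require Import all_classical all_reals all_analysis.
Set Implicit Arguments.
Unset Strict Implicit.
Unset Printing Implicit Defensive.
Import Order.TTheory GRing.Theory Num.Theory.
Import numFieldNormedType.Exports.
Local Open Scope classical_set_scope.
Local Open Scope ring_scope.

(* The spaces in use are finite-dimensional, so x |-> 'd f x is of class C^k as
   a map into linear maps iff x |-> 'D_v f x is of class C^k for every v. *)
Fixpoint is_Ck (R : realType) (V V' : normedModType R) (k : nat) (O : set V)
    (f : V -> V') : Prop :=
  if k is j.+1 then
    (forall x, O x -> differentiable f x) /\
    (forall v, is_Ck j O (fun x => 'D_v f x))
  else forall x, O x -> {for x, continuous f}.

(* [Some k] stands for the class C^k and [None] for C^oo. *)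
Definition is_Cr (R : realType) (V V' : normedModType R) (r : option nat)
    (O : set V) (f : V -> V') : Prop :=
  if r is Some k then is_Ck k O f else forall k, is_Ck k O f.

Definition cone (R : realType) (n k : nat)
    (f : 'I_k -> {linear 'rV[R]_n -> R^o}) : set 'rV[R]_n :=
  [set x | forall i, 0 <= f i x].

Definition open_in (T : topologicalType) (K A : set T) : Prop :=
  exists2 O, open O & A = K `&` O.

(* A pair [(D, kappa)] is a partial map from [T] to R^n: the domain is [D], and
   [kappa] is given the value 0 outside [D] (see [is_chart]), so that equality
   of pairs is equality of partial maps. *)
Definition prechart (R : realType) (T : Type) (n : nat) : Type :=
  (set T * (T -> 'rV[R]_n))%type.

Definition is_chart (R : realType) (T : topologicalType) (n : nat)
    (c : prechart R T n) : Prop :=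
  let: (D, kappa) := c in
  [/\ open D, (forall x, ~ D x -> kappa x = 0) &
    exists k (f : 'I_k -> {linear 'rV[R]_n -> R^o}),
      [/\ (cone f)° !=set0,
          (forall x, D x -> {for x, continuous kappa}),
          set_inj D kappa &
          forall A, open A -> A `<=` D -> open_in (cone f) (kappa @` A)]].

(* For [kappa] injective on [D], the map [kappa' \o kappa^-1 : kappa(D) -> R^n]
   extends to a C^r map on an open subset of R^m. *)
Definition Cr_expr (R : realType) (r : option nat) (T : Type) (m n : nat)
    (D : set T) (kappa : T -> 'rV[R]_m) (kappa' : T -> 'rV[R]_n) : Prop :=
  exists (Om : set 'rV[R]_m) (F : 'rV[R]_m -> 'rV[R]_n),
    [/\ open Om, kappa @` D `<=` Om, is_Cr r Om F &
        forall x, D x -> F (kappa x) = kappa' x].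

(* Families of (pre)charts; the dimension may vary from chart to chart. *)
Definition charts (R : realType) (T : Type) : Type :=
  forall n, set (prechart R T n).

Definition charts_sub (R : realType) (T : Type) (A B : charts R T) : Prop :=
  forall n, A n `<=` B n.

(* The condition on transition maps ranges over ordered pairs of charts, so it
   also covers the inverses of the transition maps. *)
Definition is_atlas (R : realType) (r : option nat) (T : topologicalType)
    (A : charts R T) : Prop :=
  [/\ forall n c, A n c -> is_chart c,
      forall x, exists n c, A n c /\ c.1 x &
      forall m n c c', A m c -> A n c' -> Cr_expr r (c.1 `&` c'.1) c.2 c'.2].

Definition is_structure (R : realType) (r : option nat) (T : topologicalType)
    (S : charts R T) : Prop :=
  is_atlas r S /\ forall B, is_atlas r B -> charts_sub S B -> charts_sub B S.

Definition restr_charts (R : realType) (T : Type) (A : charts R T) (U : set T) :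
    charts R U :=
  fun n => [set ((set_val @^-1` c.1, c.2 \o set_val) : prechart R U n) | c in A n].

Arguments restr_charts {R T} A U.

Record homeo (T T' : topologicalType) := Homeo {
  homeo_fun :> T -> T';
  homeo_invfun : T' -> T;
  homeo_cts : continuous homeo_fun;
  homeo_invcts : continuous homeo_invfun;
  homeo_funK : cancel homeo_fun homeo_invfun;
  homeo_invK : cancel homeo_invfun homeo_fun }.

Arguments homeo_cts {T T'} h.
Arguments homeo_invcts {T T'} h.

Definition homeo_inv (T T' : topologicalType) (f : homeo T T') : homeo T' T :=
  Homeo (homeo_invcts f) (homeo_cts f) (homeo_invK f) (homeo_funK f).

Definition homeo_comp (T T' T'' : topologicalType) (g : homeo T' T'')
    (f : homeo T T') : homeo T T'' :=
  @Homeo T T'' (g \o f) (homeo_invfun f \o homeo_invfun g)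
    (fun x => continuous_comp (homeo_cts f x) (homeo_cts g (f x)))
    (fun x => continuous_comp (homeo_invcts g x)
                (homeo_invcts f (homeo_invfun g x)))
    (can_comp (homeo_funK g) (homeo_funK f))
    (can_comp (homeo_invK f) (homeo_invK g)).

Definition preserves (T : topologicalType) (f : homeo T T) (A : set T) : Prop :=
  f @` A = A.

Definition Cr_map (R : realType) (r : option nat) (T T' : topologicalType)
    (A : charts R T) (A' : charts R T') (f : T -> T') : Prop :=
  continuous f /\
  forall m n c c', A m c -> A' n c' ->
    Cr_expr r (c.1 `&` f @^-1` c'.1) c.2 (c'.2 \o f).

Definition Cr_diffeo (R : realType) (r : option nat) (T T' : topologicalType)
    (A : charts R T) (A' : charts R T') (f : homeo T T') : Prop :=
  Cr_map r A A' f /\ Cr_map r A' A (homeo_inv f).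

Section RestrictHomeo.
Variables (X : topologicalType) (A W : set X) (sWA : W `<=` A).

Lemma restr_fun_subproof (f : A -> A) :
    f @` (set_val @^-1` W) = set_val @^-1` W ->
  forall w : W, W (set_val (f (subfun sWA w))).
Proof.
move=> fW w.
have : (set_val @^-1` W) (f (subfun sWA w)).
  by rewrite -fW; exists (subfun sWA w) => //=; rewrite !set_valE /=;
    exact: set_mem (valP w).
by [].
Qed.

Definition restr_fun (f : A -> A)
    (fW : f @` (set_val @^-1` W) = set_val @^-1` W) (w : W) : W :=
  SigSub (mem_set (restr_fun_subproof fW w)).

Lemma val_restr_fun (f : A -> A)
    (fW : f @` (set_val @^-1` W) = set_val @^-1` W) (w : W) :
  set_val (restr_fun fW w) = set_val (f (subfun sWA w)).
Proof. by rewrite set_valE. Qed.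

Lemma restr_fun_cts (f : A -> A)
    (fW : f @` (set_val @^-1` W) = set_val @^-1` W) :
  continuous f -> continuous (restr_fun fW).
Proof.
move=> cf; apply: continuous_comp_initial.
have -> : set_val \o restr_fun fW = set_val \o f \o subfun sWA.
  by apply/funext => w; exact: val_restr_fun.
move=> w; apply: continuous_comp; last first.
  by apply: continuous_comp; [exact: cf | exact: initial_continuous].
apply: continuous_comp_initial.
have -> : set_val \o subfun sWA = (set_val : W -> X).
  by apply/funext => z; rewrite /= !set_valE.
exact: initial_continuous.
Qed.

Lemma preserves_inv (T : topologicalType) (f : homeo T T) (B : set T) :
  preserves f B -> preserves (homeo_inv f) B.
Proof.
rewrite /preserves => fB; apply/seteqP; split=> [_ [x + <-]|x Bx].
  by rewrite -{1}fB => -[y By <-]; rewrite /= homeo_funK.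
exists (f x); last by rewrite /= homeo_funK.
by rewrite -fB; exists x.
Qed.

Lemma restr_funK (f g : A -> A)
    (fW : f @` (set_val @^-1` W) = set_val @^-1` W)
    (gW : g @` (set_val @^-1` W) = set_val @^-1` W) :
  cancel f g -> cancel (restr_fun fW) (restr_fun gW).
Proof.
move=> fK w; apply: val_inj; rewrite -[LHS]/(set_val _) val_restr_fun.
have -> : subfun sWA (restr_fun fW w) = f (subfun sWA w) by apply: val_inj.
by rewrite fK.
Qed.

Definition restr_homeo (f : homeo A A) (fW : preserves f (set_val @^-1` W)) :
    homeo W W :=
  Homeo (@restr_fun_cts f fW (homeo_cts f))
        (@restr_fun_cts _ (preserves_inv fW) (homeo_invcts f))
        (restr_funK fW (preserves_inv fW) (homeo_funK f))
        (restr_funK (preserves_inv fW) fW (homeo_invK f)).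

End RestrictHomeo.

Section GluingAtlas.
Variables (R : realType) (r : option nat) (M : topologicalType).
Variables (At : charts R M) (U V : set M).
Local Notation W := (U `&` V).

Definition transition_homeo (phi : homeo U U) (psi : homeo V V)
    (phiW : preserves phi (set_val @^-1` W))
    (psiW : preserves psi (set_val @^-1` W)) : homeo W W :=
  homeo_comp (restr_homeo (@subIsetr _ U V) psiW)
             (homeo_inv (restr_homeo (@subIsetl _ U V) phiW)).

Record UV_atlas := UVAtlas {
  uv_phi : homeo U U;
  uv_psi : homeo V V;
  uv_phiW : preserves uv_phi (set_val @^-1` W);
  uv_psiW : preserves uv_psi (set_val @^-1` W);
  uv_diffeo : Cr_diffeo r (restr_charts At W) (restr_charts At W)
                (transition_homeo uv_phiW uv_psiW) }.

Arguments uv_phiW : clear implicits.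
Arguments uv_psiW : clear implicits.

Definition transition (A : UV_atlas) : homeo W W :=
  transition_homeo (uv_phiW A) (uv_psiW A).

(* The chart [(f^-1(D), kappa \o f)] of [M], for a chart [(D, kappa)] of the
   open subset [Y]; ['valL_ 0] is the extension by 0 from [Y] to [M]. *)
Definition pull_chart (Y : set M) (f : Y -> Y) (n : nat) (c : prechart R Y n) :
    prechart R M n :=
  (set_val @` (f @^-1` c.1), 'valL_ 0 (c.2 \o f)).

Definition induced_atlas (A : UV_atlas) : charts R M := fun n =>
  [set pull_chart (uv_phi A) c | c in restr_charts At U n] `|`
  [set pull_chart (uv_psi A) c | c in restr_charts At V n].

Definition UV_structures : set (charts R M) :=
  [set S | is_structure r S /\ exists A, charts_sub (induced_atlas A) S].

Definition UV_class (S : charts R M) : set (charts R M) :=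
  [set S' | UV_structures S' /\
    exists h : homeo M M,
      [/\ preserves h U, preserves h V & Cr_diffeo r S S' h]].

Definition UV_quotient : set (set (charts R M)) :=
  [set UV_class S | S in UV_structures].

Definition diffeos : set (homeo W W) :=
  Cr_diffeo r (restr_charts At W) (restr_charts At W).

Definition extendable (Y : set M) (sWY : W `<=` Y) : set (homeo W W) :=
  [set g | exists (a : homeo Y Y) (aW : preserves a (set_val @^-1` W)),
    Cr_diffeo r (restr_charts At Y) (restr_charts At Y) a /\
    g = restr_homeo sWY aW].

Definition double_coset (g : homeo W W) : set (homeo W W) :=
  [set g' | exists a b, [/\ extendable (@subIsetl _ U V) a,
    extendable (@subIsetr _ U V) b &
    g' = homeo_comp b (homeo_comp g (homeo_inv a))]].

Definition double_cosets : set (set (homeo W W)) :=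
  [set double_coset g | g in diffeos].

End GluingAtlas.

Arguments UV_atlas {R} r {M} At U V.
Arguments uv_phiW {R r M At U V} u.
Arguments uv_psiW {R r M At U V} u.
Arguments transition {R r M At U V} A.
Arguments induced_atlas {R r M At U V} A n.
Arguments UV_structures {R} r {M} At U V.
Arguments UV_class {R} r {M} At U V S.
Arguments UV_quotient {R} r {M} At U V.
Arguments diffeos {R} r {M} At U V.
Arguments extendable {R} r {M} At {U V Y} sWY.
Arguments double_coset {R} r {M} At {U V} g.
Arguments double_cosets {R} r {M} At U V.

(* Main.v *)
Require Import Defs.
From HB Require Import structures.
From mathcomp Require Import all_boot all_order all_algebra.
From mathcomp Require Import all_classical all_reals all_analysis.
From mathcomp Require Import ring lra.
Set Implicit Arguments.
Unset Strict Implicit.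
Unset Printing Implicit Defensive.
Import Order.TTheory GRing.Theory Num.Theory.
Import numFieldNormedType.Exports.
Local Open Scope classical_set_scope.
Local Open Scope ring_scope.

(* Pulling charts back along phi and psi makes phi and psi diffeomorphisms from
   U and V, with the induced structures, onto U and V with the given ones.  So a
   diffeomorphism h between two induced structures yields a = phi' h phi^-1 and
   b = psi' h psi^-1 with g' = b g a^-1 on W; conversely, from such a and b, the
   maps phi'^-1 a phi and psi'^-1 b psi agree on W and glue to h.  As a C^r map
   must admit one extension near the image of the whole chart domain, composing
   through intermediate charts requires gluing local C^r extensions with a
   smooth partition of unity on R^n. *)

(** Charts take values in cones, so two local extensions of the same map need agree only on the
    image of the chart; near a boundary point they may differ off the cone and cannot simply be
    pasted. This is why [Cr_expr] is not visibly a local condition. The partition of unity lives on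
    R^n, reached through the chart, so a non-Hausdorff or not second countable M is no obstacle. Its
    weights are smooth to every order, so one argument serves all classes C^k and C^oo. The relation
    g' = b g a^-1 also settles surjectivity: if g is the transition map of (phi, psi), then g' is
    that of (a phi, b psi), so transition maps fill whole double cosets. A double coset is therefore
    attained iff any given representative is itself a transition map, and each (U,V)-atlas does
    yield a class once its induced atlas is enlarged to a maximal one. *)

Section Calculus.
Variable R : realType.

(** * Closure properties of the class C^k *)

Lemma near_eq_differentiable (V V' : normedModType R) (f g : V -> V') (x : V) :
  {near x, f =1 g} -> differentiable f x -> differentiable g x.
Proof.
move=> fg df.
have fgx : f x = g x by apply: nbhs_singleton fg.
have [cd ex] := (diff_locallyP x f).1 df.
have {}ex : g \o shift x = cst (g x) + 'd f x +o_ (0 : V) id.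
  apply/eqaddoP => e e0; have /eqaddoP/(_ e e0) := ex.
  move: fg; rewrite (near_shift 0) => fg; apply: filterS2 fg => h.
  by rewrite /= !fctE /= subr0 /cst /= fgx => ->.
by apply/diff_locallyP; rewrite (diff_unique cd ex).
Qed.

Lemma is_Ck_eq (V V' : normedModType R) k (O : set V) (f g : V -> V') :
  open O ->
  (forall x, O x -> f x = g x) -> is_Ck k O f -> is_Ck k O g.
Proof.
move=> oO; elim: k f g => [|k IH] f g fg /=.
  move=> cf x Ox; have := cf x Ox; rewrite /prop_for /continuous_at -(fg x Ox).
  apply: cvg_trans; apply: near_eq_cvg.
  near do apply/fg; exact: open_nbhs_nbhs.
have nfg x : O x -> {near x, f =1 g}.
  by move=> Ox; near do apply/fg; exact: open_nbhs_nbhs.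
move=> [df Df]; split=> [x Ox|v].
  exact: near_eq_differentiable (nfg x Ox) (df x Ox).
by apply: IH (Df v) => x Ox; apply: near_eq_derive; exact: nfg.
Unshelve. all: by end_near. Qed.

Lemma sub_is_Ck (V V' : normedModType R) k (O O' : set V) (f : V -> V') :
  O' `<=` O -> is_Ck k O f -> is_Ck k O' f.
Proof.
move=> OO; elim: k f => [|k IH] f /=; first by move=> cf x /OO; exact: cf.
by move=> [df Df]; split=> [x /OO|v]; [exact: df | exact/IH/Df].
Qed.

Lemma is_Ck_local (V V' : normedModType R) k (O : set V) (f : V -> V') :
  (forall x, O x -> exists2 N, nbhs x N & is_Ck k N f) -> is_Ck k O f.
Proof.
elim: k f => [|k IH] f /= H.
  by move=> x /H[N xN]; apply; exact: nbhs_singleton.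
split=> [x /H[N xN [df _]]|v]; first by apply: df; exact: nbhs_singleton.
by apply: IH => x /H[N xN [_ Df]]; exists N.
Qed.

Lemma is_CkS (V V' : normedModType R) k (O : set V) (f : V -> V') :
  is_Ck k.+1 O f -> is_Ck k O f.
Proof.
elim: k f => [|k IH] f /= [df Df].
  by move=> x Ox; apply: differentiable_continuous; exact: df.
by split=> // v; apply: IH; exact: Df.
Qed.

Lemma is_Ck_continuous (V V' : normedModType R) k (O : set V) (f : V -> V') :
  is_Ck k O f ->
  forall x, O x -> {for x, continuous f}.
Proof. by elim: k => // k IH /is_CkS. Qed.

Lemma is_Ck_cst (V V' : normedModType R) k (O : set V) (c : V') :
  is_Ck k O (fun=> c).
Proof.
elim: k c => [|k IH] c /=; first by move=> x _; exact: cvg_cst.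
split=> [x _|v]; first exact: differentiable_cst.
have -> : (fun x => 'D_v (fun=> c) x) = (fun=> 0) :> (V -> V').
  by apply/funext => x; exact: derive_cst.
exact: IH.
Qed.

Lemma is_CkD (V V' : normedModType R) k (O : set V) (f g : V -> V') : open O ->
  is_Ck k O f -> is_Ck k O g -> is_Ck k O (f \+ g).
Proof.
move=> oO; elim: k f g => [|k IH] f g /=.
  by move=> cf cg x Ox; apply: continuousD; [exact: cf|exact: cg].
move=> [df Df] [dg Dg]; split=> [x Ox|v].
  by apply: differentiableD; [exact: df|exact: dg].
apply: (is_Ck_eq oO) (IH _ _ (Df v) (Dg v)) => x Ox /=.
by rewrite deriveD//; apply: diff_derivable; [exact: df|exact: dg].
Qed.

Lemma is_Ck_sum (V V' : normedModType R) k (O : set V) n (f : 'I_n -> V -> V') :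
  open O ->
  (forall i, is_Ck k O (f i)) -> is_Ck k O (fun x => \sum_(i < n) f i x).
Proof.
move=> oO; elim: n f => [|n IH] f H.
  apply: (is_Ck_eq oO _ (is_Ck_cst k O 0)) => x _.
  by rewrite big_ord0.
have Hn := is_CkD oO (IH _ (fun i => H (widen_ord (leqnSn n) i))) (H ord_max).
by apply: (is_Ck_eq oO _ Hn) => x _; rewrite big_ord_recr.
Qed.

Lemma is_Ck_lin (V V' V'' : normedModType R) k (O : set V) (f : V -> V')
    (p : {linear V' -> V''}) :
  open O -> continuous p -> is_Ck k O f -> is_Ck k O (p \o f).
Proof.
move=> oO cp; elim: k f => [|k IH] f /=.
  by move=> cf x Ox; apply: continuous_comp; [exact: cf|exact: cp].
move=> [df Df]; split=> [x Ox|v].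
  by apply: differentiable_comp; [exact: df|exact: linear_differentiable].
apply: (is_Ck_eq oO) (IH _ (Df v)) => x Ox /=.
have dfx := df x Ox.
have dp : differentiable p (f x) by exact: linear_differentiable.
rewrite (deriveE v dfx) (deriveE v (differentiable_comp dfx dp)).
by rewrite (diff_comp dfx dp) /= (diff_lin _ cp).
Qed.

(** The product rule is the chain rule for the bilinear map [*:] applied to the pair of [f] and [g];
    hence the packing of scaling as a bilinear map on [R^o]. *)
Lemma differentiable_scale (V V' : normedModType R) (f : V -> R^o) (g : V -> V') x :
  differentiable f x -> differentiable g x ->
  differentiable (fun y => f y *: g y) x /\
  forall v, 'D_v (fun y => f y *: g y) x = f x *: 'D_v g x + 'D_v f x *: g x.
Proof.
move=> df dg.
have lin : bilinear_for
    (GRing.Scale.Law.clone _ _ *:%R _) (GRing.Scale.Law.clone _ _ *:%R _)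
    (@GRing.scale R V' : R^o -> V' -> V').
  by split=> [u'|u] a y z /=; rewrite (scalerDl, scalerDr) !scalerA // mulrC.
pose bM := bilinear_isBilinear.Build R R^o V' V' _ _ (@GRing.scale R V') lin.
pose b : {bilinear R^o -> V' -> V'} := HB.pack (@GRing.scale R V') bM.
have cb : continuous (fun p => b p.1 p.2).
  exact: scale_continuous.
have db := differentiable_bilin (f x, g x) cb.
have dfg := differentiable_pair df dg.
have dd : differentiable (fun y => f y *: g y) x.
  exact: differentiable_comp dfg db.
split=> // v; rewrite (deriveE v dd) (deriveE v df) (deriveE v dg).
have -> : 'd (fun y => f y *: g y) x v =
    'd ((fun p => b p.1 p.2) \o (fun y => (f y, g y))) x v by [].
rewrite (diff_comp dfg db) [LHS]/comp (diff_bilin (f x, g x) cb).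
by rewrite (diff_pair df dg).
Qed.

Lemma is_CkZ (V V' : normedModType R) k (O : set V)
    (f : V -> R^o) (g : V -> V') :
  open O ->
  is_Ck k O f -> is_Ck k O g -> is_Ck k O (fun x => f x *: g x).
Proof.
move=> oO; elim: k f g => [|k IH] f g.
  by move=> /= cf cg x Ox; apply: continuousZ; [exact: cf|exact: cg].
move=> /[dup] /is_CkS fk [df Df] /[dup] /is_CkS gk [dg Dg]; split=> [x Ox|v].
  exact: (differentiable_scale (df x Ox) (dg x Ox)).1.
apply: (is_Ck_eq oO) (is_CkD oO (IH _ _ fk (Dg v)) (IH _ _ (Df v) gk)).
by move=> x Ox /=; rewrite (differentiable_scale (df x Ox) (dg x Ox)).2.
Qed.

(* [e] is a basis of [V'] and [p] its coordinate forms, so that the chain rule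
   reads 'D_v (g \o f) = \sum_i p i ('D_v f) *: ('D_(e i) g \o f). *)
Lemma is_Ck_comp (V V' V'' : normedModType R) k m (e : 'I_m -> V')
    (p : 'I_m -> {linear V' -> R^o}) (O : set V) (O' : set V')
    (f : V -> V') (g : V' -> V'') :
  (forall i, continuous (p i)) -> (forall y, y = \sum_(i < m) p i y *: e i) ->
  open O -> (forall x, O x -> O' (f x)) ->
  is_Ck k O f -> is_Ck k O' g -> is_Ck k O (g \o f).
Proof.
move=> cp pe oO ff; elim: k g => [|k IH] g.
  by move=> /= cf cg x Ox; apply: continuous_comp; [exact: cf|apply/cg/ff].
move=> /[dup] /is_CkS fk [df Df] [dg Dg]; split=> [x Ox|v].
  by apply: differentiable_comp; [exact: df|apply/dg/ff].
pose h x := \sum_(i < m) p i ('D_v f x) *: ('D_(e i) g \o f) x.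
apply: (@is_Ck_eq _ _ _ _ h) => //.
  move=> x Ox; have dfx := df x Ox; have dgf := dg _ (ff _ Ox).
  rewrite (deriveE v (differentiable_comp dfx dgf)) (diff_comp dfx dgf) /=.
  rewrite -(deriveE v dfx) (pe ('D_v f x)) linear_sum; apply: eq_bigr => i _.
  by rewrite linearZ /= -(deriveE (e i) dgf).
apply: is_Ck_sum => // i; apply: is_CkZ => //.
  by apply: (@is_Ck_lin _ _ _ _ _ _ (p i)) => //; exact: Df.
by apply: IH => //; exact: Dg.
Qed.

End Calculus.

(** * Smooth bump functions on R and R^n *)

Section Bump.
Variable R : realType.

Lemma is_Ck_id (V : normedModType R) k (O : set V) : is_Ck k O (fun x => x).
Proof.
case: k => [|k] /=; first by move=> x _; exact: cvg_id.
split=> [x _|v]; first exact: ex_diff.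
have -> : (fun x => 'D_v (fun x => x) x) = (fun=> v) :> (V -> V).
  by apply/funext => x; exact: derive_id.
exact: is_Ck_cst.
Qed.

(** On the line 'D_v f = v *: 'D_1 f, so the direction 1 controls all those over which [is_Ck]
    quantifies. *)
Lemma is_CkS_derive1 k (O : set R^o) (f : R^o -> R^o) : open O ->
  (forall x, O x -> derivable f x 1) -> is_Ck k O (fun x => 'D_1 f x) ->
  is_Ck k.+1 O f.
Proof.
move=> oO df Df.
have dfx x : O x -> differentiable f x.
  by move=> Ox; apply/derivable1_diffP; exact: df.
split=> // v.
apply: (is_Ck_eq oO _ (is_CkZ oO (is_Ck_cst k O (v : R^o)) Df)) => x Ox /=.
rewrite (deriveE _ (dfx x Ox)) (deriveE _ (dfx x Ox)).
by rewrite -linearZ /= /GRing.scale /= mulr1.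
Qed.

Lemma is_Ck_comp_real (V V' : normedModType R) k (O : set V) (O' : set R^o)
    (f : V -> R^o) (g : R^o -> V') : open O -> (forall x, O x -> O' (f x)) ->
  is_Ck k O f -> is_Ck k O' g -> is_Ck k O (g \o f).
Proof.
pose p (_ : 'I_1) : {linear R^o -> R^o} := idfun.
apply: (@is_Ck_comp R V R^o V' k 1 (fun=> 1 : R^o) p).
  by move=> i x; exact: cvg_id.
by move=> y; rewrite big_ord1 /GRing.scale /= mulr1.
Qed.

(** The derivative - x^-1 * x^-1 is a product of copies of the function itself, so the induction
    closes. *)
Lemma is_Ck_inv k : is_Ck k [set x : R^o | x != 0] (fun x => x^-1 : R^o).
Proof.
have oO : open [set x : R^o | x != 0].
  exact: open_neq.
elim: k => [|k IH]; first by move=> x /= x0; exact: inv_continuous.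
apply: is_CkS_derive1 => // [x x0|].
  exact/derivable1_diffP/differentiable_Rinv.
apply: (is_Ck_eq oO _ (is_CkZ oO (is_Ck_cst k _ (-1 : R^o)) (is_CkZ oO IH IH))).
move=> x x0 /=; rewrite (deriveE _ (differentiable_Rinv x0)) diff_Rinv//.
by rewrite /GRing.scale /= mulr1 mulN1r expr2 invfM.
Qed.

(** The classical flat function exp(-1/t) is [flat 0]. The powers of 1/t are included because
    differentiation raises them: the whole family is closed under differentiation up to linear
    combinations. *)
Definition flat (n : nat) (t : R^o) : R^o :=
  if 0 < t then t^-1 ^+ n * expR (- t^-1) else 0.

(** The exponential series gives exp(1/t) >= t^-(n+1) / (n+1)! for t > 0; the one extra power of t
    forces the limit 0 at the origin. *)
Lemma flat_le n t : `|flat n t| <= n.+1`!%:R * `|t|.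
Proof.
rewrite /flat; case: ifPn => [t0|_]; last by rewrite normr0 mulr_ge0.
have tV0 : 0 < t^-1 by rewrite invr_gt0.
rewrite ger0_norm ?(gtr0_norm t0); last first.
  by rewrite mulr_ge0 ?exprn_ge0 ?expR_ge0// ltW.
rewrite expRN ler_pdivrMr ?expR_gt0//.
have /(le_trans _) H := expR_ge1Dxn n (ltW tV0).
rewrite -ler_pdivrMl ?mulr_gt0 ?ltr0n ?fact_gt0//; apply: H.
by rewrite invfM -mulrA mulrC -exprS lerDr.
Qed.

Lemma flat_cvg0 n : flat n t @[t --> (0 : R^o)] --> (0 : R^o).
Proof.
have c0 : n.+1`!%:R * `|t| @[t --> (0 : R)] --> (0 : R).
  have : n.+1`!%:R * `|t| @[t --> (0 : R)] --> n.+1`!%:R * `|0 : R|.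
    by apply: cvgMr; exact: (cvg_norm (@cvg_id _ _)).
  by rewrite normr0 mulr0.
have cN0 : - (n.+1`!%:R * `|t|) @[t --> (0 : R)] --> (0 : R).
  by rewrite -[X in _ --> X]oppr0; exact: cvgN c0.
apply: (squeeze_cvgr _ cN0 c0).
by near=> t; rewrite -ler_norml flat_le.
Unshelve. all: by end_near. Qed.

Lemma is_derive_flat n (t : R^o) :
  is_derive t 1 (flat n) (flat n.+2 t - n%:R * flat n.+1 t).
Proof.
have [t0|t0|->] := ltgtP t 0.
- have -> : flat n.+2 t - n%:R * flat n.+1 t = 0.
    by rewrite /flat ltNge (ltW t0)/= mulr0 subr0.
  apply: (@near_eq_is_derive R R^o R^o (cst 0)).
  near=> s; rewrite /flat ltNge (_ : s <= 0)//.
  by near: s; exact: lt_le_nbhsl.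
- apply: (@near_eq_is_derive R R^o R^o
    (fun s : R^o => s^-1 ^+ n * expR (- s^-1))).
    near=> s; rewrite /flat; have -> : 0 < s; last by [].
    by near: s; exact: (lt_nbhsr t0).
  have dV : is_derive (t : R) 1 (fun y : R => y^-1) (- t^-1 ^+ 2).
    have := @is_deriveV R id t 1 1 (lt0r_neq0 t0) (is_derive_id _ _).
    by rewrite exprVn /GRing.scale /= mulr1.
  have dN := is_deriveN dV.
  have dE := @is_derive1_comp R expR (- (fun y : R => y^-1)) t _ _
    (is_derive_expR _) dN.
  have D := is_deriveM (is_deriveX n dV) dE.
  rewrite /flat t0.
  have -> : (fun s : R^o => s^-1 ^+ n * expR (- s^-1)) =
      ((fun y : R => y^-1) ^+ n * (expR \o - (fun y : R => y^-1))).
    by apply/funext => s; rewrite [RHS]/GRing.mul /= exprfctE.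
  refine (is_derive_eq D _).
  rewrite /GRing.scale /= exprfctE {dV dN dE D}.
  rewrite [(- (fun y : R => y^-1)) t]/(- t^-1).
  move: (t^-1) (expR _) => u w.
  by case: n => [|n] /=; rewrite ?exprS; ring.
- have -> : flat n.+2 0 - n%:R * flat n.+1 0 = 0.
    by rewrite /flat ltxx/= mulr0 subr0.
  have H : h^-1 *: (flat n (h *: (1 : R^o) + 0) - flat n 0)
      @[h --> (0 : R)^'] --> (0 : R^o).
    (* The difference quotient at 0 is [flat n.+1 h], a member of the same family, whence its limit
       0. *)
    have H0 : flat n.+1 t @[t --> (0 : R)^'] --> (0 : R).
      by apply: cvg_within_filter; exact: flat_cvg0.
    apply: cvg_trans H0; apply: near_eq_cvg; near=> h.
    have h0 : h != 0 by near: h; exact: nbhs_dnbhs_neq.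
    rewrite /flat ltxx subr0 addr0 [h%:A]mulr1 /GRing.scale /=.
    by case: ifP => _; rewrite ?mulr0// exprS mulrA.
  apply: DeriveDef; last by apply: cvg_lim H.
  by apply/cvg_ex; exists 0.
Unshelve. all: by end_near. Qed.

Lemma is_Ck_flat k n (O : set R^o) : is_Ck k O (flat n).
Proof.
apply: (@sub_is_Ck _ _ _ _ setT) => //.
elim: k n => [|k IH] n.
  move=> t _; apply: differentiable_continuous; apply/derivable1_diffP.
  exact: (@ex_derive _ _ _ _ _ _ _ (is_derive_flat n t)).
apply: is_CkS_derive1; first exact: openT.
  by move=> t _; exact: (@ex_derive _ _ _ _ _ _ _ (is_derive_flat n t)).
have oT : open [set: R^o] by exact: openT.
have c := @is_Ck_cst R R^o R^o k setT (- n%:R).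
have S := is_CkD oT (IH n.+2) (is_CkZ oT c (IH n.+1)).
apply: (is_Ck_eq oT _ S) => t _.
rewrite (@derive_val _ _ _ _ _ _ _ (is_derive_flat n t)).
by rewrite /GRing.scale /= mulNr.
Qed.

Lemma flat_gt0 t : 0 < t -> 0 < flat 0 t.
Proof. by move=> t0; rewrite /flat t0 expr0 mul1r expR_gt0. Qed.

Lemma flat_ge0 t : 0 <= flat 0 t.
Proof. by have [/flat_gt0/ltW//|t0] := ltP 0 t; rewrite /flat ltNge t0. Qed.

Lemma flat_eq0 t : t <= 0 -> flat 0 t = 0.
Proof. by move=> t0; rewrite /flat ltNge t0. Qed.

(* The quotient is smooth since [flat 0 (4 - s^2)] and [flat 0 (s^2 - 1)] do not
   vanish simultaneously. *)
Lemma smooth_bump_real : exists b : R^o -> R^o,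
  [/\ forall k O, is_Ck k O b, forall s, `|s| <= 1 -> b s = 1 &
      forall s, 2 <= `|s| -> b s = 0].
Proof.
pose u : R^o -> R^o := flat 0 \o (fun s : R^o => 4 - s * s).
pose v : R^o -> R^o := flat 0 \o (fun s : R^o => s * s - 1).
have oT : open [set: R^o] by exact: openT.
have sq k : is_Ck k setT (fun s : R^o => s * s : R^o).
  exact: is_CkZ oT (is_Ck_id _ _) (is_Ck_id _ _).
have Cu k : is_Ck k setT u.
  apply: (@is_Ck_comp_real R^o R^o k setT setT) => //.
    apply: (is_Ck_eq oT _ (is_CkD oT (is_Ck_cst k _ (4 : R^o))
      (is_CkZ oT (is_Ck_cst k _ (-1 : R^o)) (sq k)))) => s _.
    by rewrite /GRing.scale /= mulN1r.
  exact: is_Ck_flat.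
have Cv k : is_Ck k setT v.
  apply: (@is_Ck_comp_real R^o R^o k setT setT) => //.
    exact: (is_CkD oT (sq k) (is_Ck_cst k _ (-1 : R^o))).
  exact: is_Ck_flat.
have sqE (s : R) : s * s = `|s| ^+ 2 by rewrite real_normK ?num_real// expr2.
have uv0 s : u s + v s != 0.
  (* The threshold 2 lies strictly between 1 and 4: up to it 4 - s^2 is positive, beyond it s^2 - 1
     is. *)
  have [s1|s1] := leP (s * s) 2.
    rewrite gt_eqF// ltr_pwDl ?flat_ge0// flat_gt0//; lra.
  rewrite gt_eqF// ltr_wpDl ?flat_ge0// flat_gt0//; lra.
exists (fun s => u s * (u s + v s)^-1); split=> [k O|s s1|s s2].
- apply: (@sub_is_Ck _ _ _ _ setT) => //.
  apply: is_CkZ => //.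
  apply: (@is_Ck_comp_real R^o R^o k setT _ (u \+ v) (fun x => x^-1) oT _ _
    (is_Ck_inv k)).
    by move=> s _; exact: uv0.
  exact: is_CkD oT (Cu k) (Cv k).
- have v0 : v s = 0.
    by rewrite /v /comp flat_eq0// sqE subr_le0 expr_le1.
  by have := uv0 s; rewrite v0 addr0 => /divff.
- have u0 : u s = 0.
    by rewrite /u /comp flat_eq0// sqE subr_le0; nra.
  by rewrite u0 mul0r.
Qed.

Lemma is_Ck_prod (V : normedModType R) k (O : set V) n (f : 'I_n -> V -> R^o) :
  open O -> (forall i, is_Ck k O (f i)) ->
  is_Ck k O (fun x => \prod_(i < n) f i x).
Proof.
move=> oO; elim: n f => [|n IH] f H.
  by apply: (is_Ck_eq oO _ (@is_Ck_cst R V R^o k O 1)) => x _; rewrite big_ord0.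
have Hn := is_CkZ oO (IH _ (fun i => H (widen_ord (leqnSn n) i))) (H ord_max).
by apply: (is_Ck_eq oO _ Hn) => x _; rewrite big_ord_recr.
Qed.

Lemma is_Ck_coord k n (O : set 'rV[R]_n) i :
  is_Ck k O (fun x => x 0 i : R^o).
Proof.
case: k => [|k]; first by move=> x _; exact: coord_continuous.
split=> [x _|v]; first exact: differentiable_coord.
apply: (@sub_is_Ck _ _ _ _ setT) => //.
apply: (is_Ck_eq openT _ (@is_Ck_cst R 'rV[R]_n R^o k setT (v 0 i))) => x _.
have := @derive_mx R 'rV[R]_n 1 n id x v (@derivable_id _ _ _ _).
rewrite derive_id => /matrixP/(_ 0 i).
by rewrite mxE.
Qed.

Lemma ball_rVP n (q x : 'rV[R]_n) (e : R) : 0 < e ->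
  ball q e x <-> forall i, `|x 0 i - q 0 i| < e.
Proof.
move=> e0; split=> [[_ qx] i|qx]; first by rewrite distrC; exact: qx.
by split=> // j i; rewrite (ord1 j) /ball/= distrC.
Qed.

(** Balls of R^n are cubes here, so a product of rescaled one-variable bumps works: it is 1 when
    every coordinate is within [e] of that of [q], and 0 once some coordinate is at least [2 * e]
    away, which holds outside the ball of radius [3 * e]. *)
Lemma smooth_bump_rV n (q : 'rV[R]_n) (e : R) : 0 < e ->
  exists phi : 'rV[R]_n -> R^o, [/\ forall k O, is_Ck k O phi,
    forall x, ball q e x -> phi x = 1 &
    forall x, ~ ball q (3 * e) x -> phi x = 0].
Proof.
move=> e0; have [b [bC b1 b0]] := smooth_bump_real.
exists (fun x => \prod_(i < n) b ((x 0 i - q 0 i) / e)).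
split=> [k O|x qx|x qx].
- apply: (@sub_is_Ck _ _ _ _ setT) => //.
  apply: is_Ck_prod; first exact: openT.
  move=> i; apply: (@is_Ck_comp_real 'rV[R]_n R^o k setT setT
    (fun x : 'rV[R]_n => (x 0 i - q 0 i) / e)) => //; first exact: openT.
  have oT : open [set: 'rV[R]_n] by exact: openT.
  apply: (is_Ck_eq oT _ (is_CkZ oT (is_CkD oT (@is_Ck_coord k _ setT i)
    (@is_Ck_cst R 'rV[R]_n R^o k _ (- q 0 i)))
    (@is_Ck_cst R 'rV[R]_n R^o k _ e^-1))).
  by [].
- apply: big1 => i _; apply: b1.
  rewrite normrM normfV (gtr0_norm e0) ler_pdivrMr// mul1r ltW//.
  exact: (ball_rVP q x e0).1 qx i.
- have [i qi] : exists i, 2 * e <= `|x 0 i - q 0 i|.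
    apply: contrapT => /forallNP H; apply: qx.
    have e3 : 0 < 3 * e by lra.
    apply: (ball_rVP q x e3).2 => i; have /negP := H i; rewrite -ltNge => xq.
    by apply: lt_trans xq _; lra.
  rewrite (bigD1 i)//= b0 ?mul0r//.
  by rewrite normrM normfV (gtr0_norm e0) ler_pdivlMr.
Qed.

End Bump.

(** * Gluing local C^r extensions on R^n *)

Section Gluing.
Variable R : realType.
Implicit Type r : option nat.

Lemma is_Cr_all (V V' : normedModType R) r (O : set V) (f : V -> V') :
  (forall k, is_Ck k O f) -> is_Cr r O f.
Proof. by case: r => [k|]; exact. Qed.

Lemma is_Cr_map (V V' V1 V1' : normedModType R) r (O : set V) (O1 : set V1)
    (f : V -> V') (g : V1 -> V1') :
  (forall k, is_Ck k O f -> is_Ck k O1 g) -> is_Cr r O f -> is_Cr r O1 g.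
Proof. by case: r => [k|] fg; [exact: fg | move=> + k => /(_ k); exact: fg]. Qed.

Lemma is_Cr_local (V V' : normedModType R) r (O : set V) (f : V -> V') :
  (forall x, O x -> exists2 N, nbhs x N & is_Cr r N f) -> is_Cr r O f.
Proof.
case: r => [k|] H; first exact: is_Ck_local.
by move=> k; apply: is_Ck_local => x /H[N xN fN]; exists N.
Qed.

Lemma is_Cr_eq (V V' : normedModType R) r (O : set V) (f g : V -> V') :
  open O ->
  (forall x, O x -> f x = g x) -> is_Cr r O f -> is_Cr r O g.
Proof. by move=> oO fg; apply: is_Cr_map => k; exact: is_Ck_eq. Qed.

Lemma is_Cr_continuous (V V' : normedModType R) r (O : set V) (f : V -> V') :
  is_Cr r O f -> forall x, O x -> {for x, continuous f}.
Proof.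
by case: r => [k|fO]; [exact: is_Ck_continuous | exact: (is_Ck_continuous (fO 0))].
Qed.

Lemma is_Cr_comp r l m n (O : set 'rV[R]_l) (O' : set 'rV[R]_m)
    (f : 'rV[R]_l -> 'rV[R]_m) (g : 'rV[R]_m -> 'rV[R]_n) :
  open O -> (forall x, O x -> O' (f x)) ->
  is_Cr r O f -> is_Cr r O' g -> is_Cr r O (g \o f).
Proof.
move=> oO fO.
have cp k : is_Ck k O f -> is_Ck k O' g -> is_Ck k O (g \o f).
  have lin i : linear (fun y : 'rV[R]_m => y 0 i : R^o).
    by move=> a x y; rewrite !mxE.
  pose pM i := GRing.isLinear.Build R _ _ _ _ (lin i).
  pose p i : {linear 'rV[R]_m -> R^o} := HB.pack (fun y : 'rV[R]_m => y 0 i) (pM i).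
  apply: (@is_Ck_comp _ _ _ _ _ m (fun i => 'e_i) p) => //.
    by move=> i x; exact: coord_continuous.
  by move=> y; exact: row_sum_delta.
by case: r => [k|Hf Hg k]; exact: cp.
Qed.

Definition rV_ratr m (q : 'rV[rat]_m) : 'rV[R]_m := map_mx ratr q.

(** Balls with rational centre and radius form a countable family, so the cover in [is_Cr_glue] can
    be indexed by natural numbers. The concentric ball four times larger leaves room for a bump to
    fall to 0 inside [Om]. *)
Lemma rat_ball m (y : 'rV[R]_m) (Om : set 'rV[R]_m) : open Om -> Om y ->
  exists (q : 'rV[rat]_m) (e : rat),
    [/\ 0 < e, ball (rV_ratr q) (ratr e) y &
        ball (rV_ratr q) (4 * ratr e) `<=` Om].
Proof.
move=> oOm Oy; have /nbhs_ballP[d /= d0 dOm] := open_nbhs_nbhs (conj oOm Oy).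
(* The centre will lie within [e] of [y], so its ball of radius [4 * e] stays within [5 * e < d] of
   [y]. *)
have [e] : exists e : rat, 0 < (ratr e : R) < d / 5.
  have /rat_in_itvoo[e] : 0 < d / 5 by rewrite divr_gt0.
  by rewrite in_itv; exists e.
rewrite ltr0q => /andP[e0 ed]; have re0 : 0 < (ratr e : R) by rewrite ltr0q.
have /choice[q qP] i : exists q : rat, `|y 0 i - ratr q| < ratr e.
  have /rat_in_itvoo[q] : y 0 i - ratr e < y 0 i + ratr e by lra.
  by rewrite in_itv /= => qy; exists q; rewrite ltr_norml; lra.
have qe : ball (rV_ratr (\row_i q i)) (ratr e) y.
  by apply: (ball_rVP _ _ re0).2 => i; rewrite !mxE.
exists (\row_i q i), e; split=> // x qx; apply: dOm.
apply: (@le_ball _ _ _ (ratr e + 4 * ratr e)); first lra.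
exact: ball_triangle (ball_sym qe) qx.
Qed.

(* [G] is [phi *: F], of class C^r everywhere because [phi] vanishes near every
   point where [F] is not known to be regular. *)
Lemma smooth_cutoff r m n (E Om : set 'rV[R]_m) (f F : 'rV[R]_m -> 'rV[R]_n)
    (q : 'rV[R]_m) (e : R) : 0 < e -> ball q (4 * e) `<=` Om ->
  is_Cr r Om F -> (forall z, E z -> Om z -> F z = f z) ->
  exists (phi : 'rV[R]_m -> R^o) (G : 'rV[R]_m -> 'rV[R]_n),
    [/\ forall k, is_Ck k setT phi, is_Cr r setT G,
        forall x, ball q e x -> phi x = 1 &
        forall z, E z -> G z = phi z *: f z].
Proof.
move=> e0 qOm CF Ff; have [phi [Cphi phi1 phi0]] := smooth_bump_rV q e0.
(* The bump vanishes outside radius [3 * e]; the margin up to [4 * e] makes it vanish on a whole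
   [e]-ball around any point farther out. *)
have phiOm x : ~ ball q (4 * e) x -> nbhs x [set y | phi y = 0].
  move=> qx; have := nbhsx_ballx x e e0; apply: filterS => y xy.
  apply: phi0 => qy; apply: qx; have -> : 4 * e = 3 * e + e by ring.
  exact: ball_triangle qy (ball_sym xy).
exists phi, (fun x => phi x *: F x); split=> // [|z Ez].
  apply: is_Cr_local => x _.
  have [qx|qx] := pselect (ball q (4 * e) x).
    have oB : open (ball q (4 * e)) by apply: ball_open; rewrite mulr_gt0.
    exists (ball q (4 * e)); first exact: open_nbhs_nbhs.
    apply: is_Cr_map CF => k CF; apply: is_CkZ => //.
    exact: sub_is_Ck CF.
  have := phiOm _ qx; rewrite {1}nbhsE => -[N [oN Nx] N0].
  exists N; first exact: open_nbhs_nbhs.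
  apply: is_Cr_all => k; apply: (is_Ck_eq oN _ (is_Ck_cst k N 0)) => y Ny.
  by rewrite N0// scale0r.
have [qz|/phiOm/nbhs_singleton->] := pselect (ball q (4 * e) z).
  by rewrite Ff//; exact: qOm.
by rewrite !scale0r.
Qed.

(* Given a countable cover [B i] and smooth [phi i] with [phi i = 1] on [B i],
   the functions [phi i * P i], where [P i] is the product of the [1 - phi j] for
   [j < i], form a partition of unity which is locally finite for free: [P i]
   vanishes on [B j] as soon as [j < i]. *)
Lemma is_Cr_glue r m n (E : set 'rV[R]_m) (f : 'rV[R]_m -> 'rV[R]_n) :
  (forall y, E y -> exists Om F, [/\ open Om, Om y, is_Cr r Om F &
    forall z, E z -> Om z -> F z = f z]) ->
  exists Om F, [/\ open Om, E `<=` Om, is_Cr r Om F &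
    forall z, E z -> F z = f z].
Proof.
move=> loc.
(* Data are chosen for all rational balls at once. A ball on whose enlargement no local extension is
   available gets the empty set and zero functions, which satisfy the same conditions and contribute
   nothing. *)
have bumps (c : 'rV[rat]_m * rat) : exists D : set 'rV[R]_m *
    (('rV[R]_m -> R^o) * ('rV[R]_m -> 'rV[R]_n)),
  [/\ open D.1, forall k, is_Ck k setT D.2.1, is_Cr r setT D.2.2,
     (forall x, D.1 x -> D.2.1 x = 1) &
     (forall z, E z -> D.2.2 z = D.2.1 z *: f z)] /\
  ((exists Om F, [/\ 0 < c.2, ball (rV_ratr c.1) (4 * ratr c.2) `<=` Om,
     is_Cr r Om F & forall z, E z -> Om z -> F z = f z]) ->
   D.1 = ball (rV_ratr c.1) (ratr c.2)).
  have [[Om [F [c0 cOm CF Ff]]]|nP] := pselect (exists Om F, [/\ 0 < c.2,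
    ball (rV_ratr c.1) (4 * ratr c.2) `<=` Om,
     is_Cr r Om F & forall z, E z -> Om z -> F z = f z]); last first.
    exists (set0, (fun=> 0, fun=> 0)); split; last by move/nP.
    split=> [|k||x []|z _]; [exact: open0|exact: is_Ck_cst| | ].
      by apply: is_Cr_all => k; exact: is_Ck_cst.
    by rewrite scale0r.
  have e0 : 0 < (ratr c.2 : R) by rewrite ltr0q.
  have [phi [G [Cphi CG phi1 Gf]]] := smooth_cutoff e0 cOm CF Ff.
  exists (ball (rV_ratr c.1) (ratr c.2), (phi, G)); split=> //; split=> //.
  exact: ball_open.
have {bumps}[D DP] := choice bumps.
pose d i := D (odflt (0, 0) (unpickle i)).
pose B i := (d i).1; pose phi i := (d i).2.1; pose G i := (d i).2.2.
have oB i : open (B i) by have [[]] := DP (odflt (0, 0) (unpickle i)).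
have Cphi i k : is_Ck k setT (phi i).
  by have [[]] := DP (odflt (0, 0) (unpickle i)).
have CG i : is_Cr r setT (G i) by have [[]] := DP (odflt (0, 0) (unpickle i)).
have phi1 i x : B i x -> phi i x = 1.
  by have [[_ _ _]] := DP (odflt (0, 0) (unpickle i)) => + _ _; exact.
have Gf i z : E z -> G i z = phi i z *: f z.
  by have [[_ _ _ _]] := DP (odflt (0, 0) (unpickle i)) => + _; exact.
have EB y : E y -> exists i, B i y.
  move=> Ey; have [Om [F [oOm Oy CF Ff]]] := loc _ Ey.
  have [q [e [e0 qy qOm]]] := rat_ball oOm Oy.
  exists (pickle (q, e)); rewrite /B /d pickleK /=.
  by have [_ ->] := DP (q, e); last by exists Om, F.
pose P i x : R^o := \prod_(j < i) (1 - phi j x).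
pose S i x := \sum_(j < i) P j x *: G j x.
have oT : open [set: 'rV[R]_m] by exact: openT.
have CP i k : is_Ck k setT (P i).
  apply: is_Ck_prod => // j.
  apply: (is_Ck_eq oT _ (is_CkD oT (@is_Ck_cst R 'rV[R]_m R^o k _ 1)
    (is_CkZ oT (@is_Ck_cst R 'rV[R]_m R^o k _ (-1)) (Cphi j k)))) => x _.
  by rewrite /GRing.scale /= mulN1r.
have CS i : is_Cr r setT (S i).
  have CSk k : (forall j, is_Ck k setT (G j)) -> is_Ck k setT (S i).
    by move=> CGk; apply: is_Ck_sum => // j; exact: is_CkZ.
  by move: CG; case: (r) => [k CGr|CGr k]; apply: CSk => // j; exact: CGr.
(* The weights telescope: [P j * phi j] is P j - P (j+1), so those below [i] add up to 1 - P i. *)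
have SE i x : E x -> S i x = (1 - P i x) *: f x.
  move=> Ex; elim: i => [|i IH].
    by rewrite /S /P !big_ord0 subrr scale0r.
  rewrite /S big_ord_recr /= -/(S i x) IH Gf// scalerA -scalerDl.
  by congr (_ *: _); rewrite /P big_ord_recr /=; ring.
have P0 i j x : B j x -> (j < i)%N -> P i x = 0.
  by move=> Bx ji; rewrite /P (bigD1 (Ordinal ji))//= phi1// subrr mul0r.
have Sst i j x : B j x -> (j < i)%N -> S i x = S j.+1 x.
  move=> Bx; elim: i => // i IH; rewrite ltnS leq_eqVlt => /predU1P[->//|ji].
  by rewrite /S big_ord_recr /= -/(S i x) IH// (P0 i j)// scale0r addr0.
(* [N x] is some index whose set contains [x]. It may vary wildly with [x], but the partial sums at
   [x] are constant past any such index, so on [B i] the glued map is the fixed function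
   [S i.+1]. *)
have /choice[N NP] x : exists i, (exists j, B j x) -> B i x.
  by have [[j Bj]|nB] := pselect (exists j, B j x); [exists j|exists 0%N].
have FE i x : B i x -> S (N x).+1 x = S i.+1 x.
  move=> Bx; have BN : B (N x) x by apply: NP; exists i.
  rewrite -(Sst (maxn (N x) i).+1 (N x))// ?ltnS ?leq_maxl//.
  by rewrite (Sst _ i)// ltnS leq_maxr.
exists (\bigcup_i B i), (fun x => S (N x).+1 x); split.
- by apply: bigcup_open => i _.
- by move=> y /EB[i Bi]; exists i.
- apply: is_Cr_local => x [i _ Bx]; exists (B i); first exact: open_nbhs_nbhs.
  apply: (is_Cr_eq (oB i) (f := S i.+1)) => [y By|]; first by rewrite (FE i).
  by apply: is_Cr_map (CS i.+1) => k; exact: sub_is_Ck.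
- move=> z Ez; have [i Bz] := EB _ Ez.
  by rewrite SE// (P0 _ (N z))// ?subr0 ?scale1r//; apply: NP; exists i.
Qed.

End Gluing.

(** * Charts, C^r maps and their locality *)

Section Charts.
Variables (R : realType) (r : option nat).

Lemma Cr_expr_eq (T : Type) m n (D D' : set T) (k k1 : T -> 'rV[R]_m)
    (l l1 : T -> 'rV[R]_n) :
  D `<=` D' -> {in D, k =1 k1} -> {in D, l =1 l1} ->
  Cr_expr r D' k l -> Cr_expr r D k1 l1.
Proof.
move=> DD kk ll [Om [F [oOm kOm CF Fk]]]; exists Om, F; split=> //.
  by move=> _ [x Dx <-]; apply: kOm; exists x; [exact: DD|rewrite kk// inE].
by move=> x Dx; rewrite -kk ?inE// -ll ?inE//; apply: Fk; exact: DD.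
Qed.

Lemma sub_Cr_expr (T : Type) m n (D D' : set T) (k : T -> 'rV[R]_m)
    (l : T -> 'rV[R]_n) :
  D `<=` D' -> Cr_expr r D' k l -> Cr_expr r D k l.
Proof. by move=> DD; exact: Cr_expr_eq. Qed.

Lemma Cr_expr_trans (T : Type) m n p (D : set T) (k : T -> 'rV[R]_m)
    (l : T -> 'rV[R]_n) (q : T -> 'rV[R]_p) :
  Cr_expr r D k l -> Cr_expr r D l q -> Cr_expr r D k q.
Proof.
move=> [Om [F [oOm kOm CF Fk]]] [Om' [F' [oOm' lOm CF' Fl]]].
have oI : open (Om `&` F @^-1` Om').
  rewrite openE => x [Omx Omx']; apply: filterI; first exact: open_nbhs_nbhs.
  by apply: (is_Cr_continuous CF Omx); exact: open_nbhs_nbhs.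
exists (Om `&` F @^-1` Om'), (F' \o F); split=> //.
- move=> _ [x Dx <-]; split; first by apply: kOm; exists x.
  by rewrite /= Fk//; apply: lOm; exists x.
- apply: is_Cr_comp CF' => //; first by move=> x [].
  by apply: is_Cr_map CF => j; apply: sub_is_Ck => x [].
- by move=> x Dx /=; rewrite Fk// Fl.
Qed.

Lemma Cr_expr_pull (T T' : Type) m n (g : T -> T') (D : set T) (D' : set T')
    (k : T' -> 'rV[R]_m) (l : T' -> 'rV[R]_n) :
  (forall x, D x -> D' (g x)) -> Cr_expr r D' k l ->
  Cr_expr r D (k \o g) (l \o g).
Proof.
move=> gD [Om [F [oOm kOm CF Fk]]]; exists Om, F; split=> //.
  by move=> _ [x Dx <-]; apply: kOm; exists (g x) => //; exact: gD.
by move=> x Dx; apply: Fk; exact: gD.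
Qed.

Lemma Cr_expr_push (T T' : Type) m n (g : T -> T') (D : set T)
    (k : T' -> 'rV[R]_m) (l : T' -> 'rV[R]_n) :
  Cr_expr r D (k \o g) (l \o g) -> Cr_expr r (g @` D) k l.
Proof.
move=> [Om [F [oOm kOm CF Fk]]]; exists Om, F; split=> //.
  by move=> _ [_ [x Dx <-] <-]; apply: kOm; exists x.
by move=> _ [x Dx <-]; exact: Fk.
Qed.

(** Here [is_Cr_glue] enters, and being C^r becomes checkable near each point. As [c.2] is injective
    on its domain, [l] factors through it by a function [g] on the image of [D], and the local
    extensions of [g] are glued in R^m. *)
Lemma Cr_expr_local (T : topologicalType) m n (c : prechart R T m) (D : set T)
    (l : T -> 'rV[R]_n) : is_chart c -> D `<=` c.1 ->
  (forall x, D x -> exists N, [/\ open N, N x & Cr_expr r (D `&` N) c.2 l]) ->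
  Cr_expr r D c.2 l.
Proof.
case: c => C k [oC _ [j [f [_ ck ik ok]]]] /= DC loc.
have /choice[g gP] y : exists z, forall x, D x -> k x = y -> z = l x.
  have [[x Dx kx]|nD] := pselect (exists2 x, D x & k x = y).
    exists (l x) => x' Dx' kx'; congr (l _).
    by apply: ik; rewrite ?inE; [exact: DC|exact: DC|rewrite kx].
  by exists 0 => x Dx kx; case: nD; exists x.
have [y [x Dx <-]|Om [F [oOm kOm CF Fg]]] := @is_Cr_glue R r m n (k @` D) g.
  have [N [oN Nx [Om [F [oOm kOm CF Fl]]]]] := loc _ Dx.
  (* [P] cuts [Om] down to a neighbourhood whose points in the cone come from [N]. A point of [D]
     outside [N] could have its image in [Om], where [F] is unrelated to [l]. *)
  have [P oP kP] := ok (C `&` N) (openI oC oN) (@subIsetl _ _ _).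
  have [Q oQ kQ] := ok C oC (@subset_refl _ _).
  exists (Om `&` P), F; split.
  - exact: openI.
  - split; first by apply: kOm; exists x.
    have : (k @` (C `&` N)) (k x) by exists x => //; split=> //; exact: DC.
    by rewrite kP => -[].
  - by apply: is_Cr_map CF => i; exact: sub_is_Ck (@subIsetl _ _ _).
  move=> _ [x' Dx' <-] [Omx' Px'].
  have : (cone f `&` Q) (k x') by rewrite -kQ; exists x' => //; exact: DC.
  move=> [Kx' _]; have : (cone f `&` P) (k x') by [].
  rewrite -kP => -[x2 [Cx2 Nx2] kx2].
  have x2E : x2 = x' by apply: ik => //; rewrite inE//; exact: DC.
  by rewrite Fl -?x2E ?x2E ?(gP _ x')//; split=> //; rewrite -x2E.
exists Om, F; split=> // x Dx; rewrite Fg; last by exists x.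
exact: gP.
Qed.

Lemma is_chart_comp (T T' : topologicalType) n (g : T -> T') (c : prechart R T' n) :
  continuous g -> injective g -> (forall A, open A -> open (g @` A)) ->
  is_chart c -> is_chart ((g @^-1` c.1, c.2 \o g) : prechart R T n).
Proof.
case: c => C k cg ig og [oC k0 [j [f [f0 ck ik ok]]]]; split.
- by move/continuousP: cg; exact.
- by move=> x /= /k0.
exists j, f; split.
- exact: f0.
- by move=> x Cgx; apply: continuous_comp; [exact: cg|exact: ck].
- by move=> x y; rewrite !inE => Cx Cy /ik kxy; apply: ig; apply: kxy; rewrite inE.
- move=> A oA AC; rewrite -image_comp; apply: ok; first exact: og.
  by move=> _ [x Ax <-]; exact: AC.
Qed.

(** Together with [is_chart_comp] this handles [pull_chart]: a chart of [Y] is composed with a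
    homeomorphism, then carried along the inclusion. The value 0 off the range is the normalisation
    imposed by [is_chart]. *)
Lemma is_chart_push (T T' : topologicalType) n (e : T -> T') (c : prechart R T n)
    (k : T' -> 'rV[R]_n) :
  continuous e -> injective e -> (forall A, open A -> open (e @` A)) ->
  k \o e = c.2 -> (forall y, ~ range e y -> k y = 0) ->
  is_chart c -> is_chart ((e @` c.1, k) : prechart R T' n).
Proof.
case: c => C kC ce ie oe /= ke k0 [oC kC0 [j [f [f0 ck ik ok]]]].
have keE x : k (e x) = kC x by rewrite -ke.
split; first exact: oe.
  move=> y nCy; have [[x _ xy]|/k0//] := pselect (range e y).
  by rewrite -xy keE kC0// => Cx; apply: nCy; exists x.
exists j, f; split.
- exact: f0.
- move=> _ [x Cx <-] A; rewrite /= keE => /(ck x Cx).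
  rewrite /= !nbhsE /= => -[N [oN Nx] NA]; exists (e @` N).
    by split; [exact: oe|exists x].
  by move=> _ [z Nz <-]; rewrite /= keE; exact: NA.
- move=> _ _ /set_mem[x Cx <-] /set_mem[y Cy <-]; rewrite !keE => kxy.
  by congr (e _); apply: ik; rewrite ?inE.
- move=> A oA AC; have -> : k @` A = kC @` (e @^-1` A).
    apply/seteqP; split=> [_ [y Ay <-]|_ [x Ax <-]]; last first.
      by exists (e x); rewrite ?keE.
    by have [x Cx xy] := AC _ Ay; exists x; rewrite /= ?xy// -keE xy.
  apply: ok; first by move/continuousP: ce; exact.
  by move=> x /= /AC[z Cz /ie <-].
Qed.

Lemma set_val_cts (T : topologicalType) (Y : set T) :
  continuous (set_val : Y -> T).
Proof. exact: initial_continuous. Qed.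

Lemma set_val_inj (T : Type) (Y : set T) : injective (set_val : Y -> T).
Proof. by move=> x y; rewrite !set_valE; exact: val_inj. Qed.

Lemma set_val_open (T : topologicalType) (Y : set T) : open Y ->
  forall A : set Y, open A -> open ((set_val : Y -> T) @` A).
Proof.
move=> oY A [B oB <-]; have -> : (set_val : Y -> T) @` (set_val @^-1` B) = Y `&` B.
  apply/seteqP; split=> [_ [y By <-]|x [Yx Bx]].
    by split=> //; rewrite set_valE; exact: set_mem (valP y).
  by exists (SigSub (mem_set Yx)); rewrite /= !set_valE.
exact: openI.
Qed.

Lemma set_valP (T : Type) (Y : set T) (y : Y) : Y (set_val y).
Proof. by rewrite set_valE; exact: set_mem (valP y). Qed.

Lemma set_val_ex (T : Type) (Y : set T) x : Y x -> exists y : Y, set_val y = x.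
Proof. by move=> Yx; exists (SigSub (mem_set Yx)); rewrite set_valE. Qed.

Lemma restr_atlas (T : topologicalType) (A : charts R T) (Y : set T) :
  open Y -> is_atlas r A -> is_atlas r (restr_charts A Y).
Proof.
move=> oY [chA cvA trA]; split.
- move=> n _ [c Ac <-]; apply: is_chart_comp; last exact: chA.
  + exact: set_val_cts.
  + exact: set_val_inj.
  + exact: set_val_open.
- move=> y; have [n [c [Ac cy]]] := cvA (set_val y).
  by exists n, (set_val @^-1` c.1, c.2 \o set_val); split=> //; exists c.
- move=> m n _ _ [c Ac <-] [c' Ac' <-] /=.
  exact: Cr_expr_pull (trA _ _ _ _ Ac Ac').
Qed.

Lemma is_chart_open (T : topologicalType) n (c : prechart R T n) :
  is_chart c -> open c.1.
Proof. by case: c => C k []. Qed.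

(** No single chart of the middle space need contain the image of a chart domain, so the composite
    is seen to be C^r only near each [x], through a chart around [f x]; [Cr_expr_local] turns this
    into one extension. *)
Lemma Cr_map_comp (T T' T'' : topologicalType) (A : charts R T)
    (A' : charts R T') (A'' : charts R T'') (f : T -> T') (g : T' -> T'') :
  is_atlas r A -> is_atlas r A' ->
  Cr_map r A A' f -> Cr_map r A' A'' g -> Cr_map r A A'' (g \o f).
Proof.
move=> [chA _ _] [chA' cvA' _] [cf Cf] [cg Cg]; split.
  by move=> x; apply: continuous_comp; [exact: cf|exact: cg].
move=> m n c c' Ac Ac'; apply: Cr_expr_local; first exact: chA.
  exact: subIsetl.
move=> x [cx c'x]; have [p [d [Ad dx]]] := cvA' (f x).
exists (f @^-1` d.1); split=> //.
  by move/continuousP: cf; apply; exact: is_chart_open (chA' _ _ Ad).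
apply: (@Cr_expr_trans _ _ _ _ _ _ (d.2 \o f)).
  by apply: sub_Cr_expr (Cf _ _ _ _ Ac Ad) => z [[]].
by apply: Cr_expr_pull (Cg _ _ _ _ Ad Ac') => z [[]].
Qed.

Lemma Cr_diffeo_comp (T T' T'' : topologicalType) (A : charts R T)
    (A' : charts R T') (A'' : charts R T'') (f : homeo T T') (g : homeo T' T'') :
  is_atlas r A -> is_atlas r A' -> is_atlas r A'' ->
  Cr_diffeo r A A' f -> Cr_diffeo r A' A'' g ->
  Cr_diffeo r A A'' (homeo_comp g f).
Proof.
move=> aA aA' aA'' [f1 f2] [g1 g2].
by split; [exact: (Cr_map_comp aA aA' f1 g1)|exact: (Cr_map_comp aA'' aA' g2 f2)].
Qed.

Lemma Cr_diffeo_inv (T T' : topologicalType) (A : charts R T)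
    (A' : charts R T') (f : homeo T T') :
  Cr_diffeo r A A' f -> Cr_diffeo r A' A (homeo_inv f).
Proof. by case. Qed.

Definition homeo_id (T : topologicalType) : homeo T T :=
  Homeo (fun x => cvg_id) (fun x => cvg_id) (fun=> erefl) (fun=> erefl).

Lemma Cr_diffeo_id (T : topologicalType) (A : charts R T) :
  is_atlas r A -> Cr_diffeo r A A (homeo_id T).
Proof.
move=> [_ _ trA]; have id_map : Cr_map r A A idfun.
  by split=> [x|m n c c' Ac Ac']; [exact: cvg_id|exact: trA].
by split.
Qed.

Lemma Cr_map_restr (T : topologicalType) (A A' : charts R T) (Y : set T)
    (h : T -> T) (hY : Y -> Y) : continuous hY ->
  (forall y, set_val (hY y) = h (set_val y)) ->
  Cr_map r A A' h -> Cr_map r (restr_charts A Y) (restr_charts A' Y) hY.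
Proof.
move=> chY hYE [ch Ch]; split=> // m n _ _ [c Ac <-] [c' Ac' <-] /=.
apply: Cr_expr_eq (Cr_expr_pull (g := set_val)
  (D := set_val @^-1` (c.1 `&` h @^-1` c'.1)) _ (Ch _ _ _ _ Ac Ac')) => //.
  by move=> y [/= cy c'y]; split=> //=; rewrite -hYE.
by move=> y _ /=; rewrite hYE.
Qed.

Lemma Cr_map_glue (T : topologicalType) (A A' : charts R T) (U V : set T)
    (h : T -> T) (hU : U -> U) (hV : V -> V) :
  is_atlas r A -> open U -> open V -> U `|` V = setT -> continuous h ->
  (forall y, set_val (hU y) = h (set_val y)) ->
  (forall y, set_val (hV y) = h (set_val y)) ->
  Cr_map r (restr_charts A U) (restr_charts A' U) hU ->
  Cr_map r (restr_charts A V) (restr_charts A' V) hV ->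
  Cr_map r A A' h.
Proof.
move=> [chA _ _] oU oV UV ch hUE hVE CU CV; split=> // m n c c' Ac Ac'.
have on (Y : set T) (hY : Y -> Y) : (forall y, set_val (hY y) = h (set_val y)) ->
    Cr_map r (restr_charts A Y) (restr_charts A' Y) hY ->
    Cr_expr r ((c.1 `&` h @^-1` c'.1) `&` Y) c.2 (c'.2 \o h).
  move=> hYE [_ CY].
  have := CY m n _ _ (ex_intro2 _ _ c Ac erefl) (ex_intro2 _ _ c' Ac' erefl).
  move=> /= CYc.
  have -> : (c.1 `&` h @^-1` c'.1) `&` Y =
      (set_val : Y -> T) @` (set_val @^-1` (c.1 `&` h @^-1` c'.1)).
    apply/seteqP; split=> [x [cx Yx]|_ [y cy <-]].
      have [y yx] := @set_val_ex _ Y _ Yx.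
      by exists y; rewrite //= yx.
    by split=> //; exact: set_valP.
  apply: Cr_expr_push; apply: Cr_expr_eq CYc => //.
    by move=> y [/= cy c'y]; split=> //=; rewrite hYE.
  by move=> y _ /=; rewrite hYE.
apply: Cr_expr_local; [exact: chA|exact: subIsetl|] => x _.
have [Ux|Vx] : (U `|` V) x by rewrite UV.
  by exists U; split=> //; exact: on hUE CU.
by exists V; split=> //; exact: on hVE CV.
Qed.

Lemma valL_val (T : Type) (Y : set T) n (g : Y -> 'rV[R]_n) y :
  'valL_ 0 g (set_val y) = g y.
Proof. by have := @valLK T 'rV[R]_n 0 Y g => /(congr1 (fun h => h y)). Qed.

Lemma valL_out (T : Type) (Y : set T) n (g : Y -> 'rV[R]_n) x :
  ~ Y x -> 'valL_ 0 g x = 0.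
Proof.
by move=> nYx; rewrite /valL_ /= oinv_set_val insubN// notin_setE.
Qed.

Lemma pull_chart_is_chart (T : topologicalType) (Y : set T) (f : homeo Y Y) n
    (c : prechart R Y n) : open Y -> is_chart c -> is_chart (pull_chart f c).
Proof.
move=> oY chc; apply: (@is_chart_push _ _ _ set_val (f @^-1` c.1, c.2 \o f)).
- exact: set_val_cts.
- exact: set_val_inj.
- exact: set_val_open.
- by apply/funext => y; exact: valL_val.
- move=> x nYx; apply: valL_out => Yx; apply: nYx; have [y yx] := @set_val_ex _ Y _ Yx.
  by exists y.
apply: is_chart_comp chc; first exact: homeo_cts.
  exact: can_inj (homeo_funK f).
move=> A oA; have -> : f @` A = homeo_invfun f @^-1` A.
  apply/seteqP; split=> [_ [x Ax <-]|x Ax]; first by rewrite /= homeo_funK.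
  by exists (homeo_invfun f x); rewrite ?homeo_invK.
by have /continuousP := homeo_invcts f; exact.
Qed.

(** Read in charts [c] of [S] and [d] of [A], the map [f] is the transition from [c] to
    [pull_chart f d]. Both are charts of [S], so compatibility inside [S] makes [f] and its inverse
    C^r. *)
Lemma pull_chart_diffeo (T : topologicalType) (Y : set T) (f : homeo Y Y)
    (S : charts R T) (A : charts R Y) : is_atlas r S ->
  (forall n c, A n c -> S n (pull_chart f c)) ->
  Cr_diffeo r (restr_charts S Y) A f.
Proof.
move=> [_ _ trS] AS; split; split.
- exact: homeo_cts.
- move=> m n _ d [c Sc <-] Ad /=.
  have := trS _ _ _ _ Sc (AS _ _ Ad) => /(Cr_expr_pull (g := set_val : Y -> T)
    (D := (set_val @^-1` c.1) `&` (f @^-1` d.1))).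
  move=> H; apply: Cr_expr_eq (H _) => //; first by move=> y _; exact: valL_val.
  by move=> y [cy dy]; split=> //; exists y.
- exact: homeo_invcts.
- move=> m n d _ Ad [c Sc <-] /=.
  have := trS _ _ _ _ (AS _ _ Ad) Sc => /(Cr_expr_pull
    (g := (set_val : Y -> T) \o homeo_invfun f)
    (D := d.1 `&` (homeo_invfun f @^-1` (set_val @^-1` c.1)))).
  move=> H; apply: Cr_expr_eq (H _) => //.
    by move=> y _; apply: (etrans (valL_val _ _)); rewrite /= homeo_invK.
  by move=> y [dy cy]; split=> //; exists (homeo_invfun f y); rewrite //= homeo_invK.
Qed.

End Charts.

(** The inverse is determined by the map and the remaining fields are proofs, so equations between
    elements of double cosets can be checked pointwise. *)
Lemma homeo_ext (T T' : topologicalType) (f g : homeo T T') : f =1 g -> f = g.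
Proof.
case: f g => [f f' cf cf' fK f'K] [g g' cg cg' gK g'K] /= fg.
have {}fg : f = g by apply/funext.
subst g; have fg' : f' = g' by apply/funext => y; rewrite -[y in LHS]g'K fK.
subst g'; congr Homeo; exact: Prop_irrelevance.
Qed.

(** * Restricting and gluing homeomorphisms *)

Section Homeos.
Variable T : topologicalType.

Lemma preservesP (f : homeo T T) (B : set T) :
  preserves f B <-> forall x, B x <-> B (f x).
Proof.
split=> [fB x|fB].
  split=> [Bx|]; first by rewrite -fB; exists x.
  by rewrite -{1}fB => -[y By /(can_inj (homeo_funK f)) <-].
apply/seteqP; split=> [_ [x Bx <-]|x Bx]; first exact: (fB x).1.
by exists (homeo_invfun f x); rewrite ?homeo_invK//; apply/fB; rewrite homeo_invK.
Qed.

Lemma preserves_comp (f g : homeo T T) (B : set T) :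
  preserves f B -> preserves g B -> preserves (homeo_comp g f) B.
Proof.
move=> /preservesP fB /preservesP gB; apply/preservesP => x.
exact: iff_trans (fB x) (gB (f x)).
Qed.

Variables (Y W : set T) (sWY : W `<=` Y).

Lemma subfun_val (w : W) : set_val (subfun sWY w) = set_val w.
Proof. by rewrite !set_valE. Qed.

Lemma subfun_restr (f : homeo Y Y) (fW : preserves f (set_val @^-1` W)) (w : W) :
  subfun sWY (restr_homeo sWY fW w) = f (subfun sWY w).
Proof. by apply: set_val_inj; rewrite subfun_val val_restr_fun. Qed.

Lemma restr_homeo_comp (f g : homeo Y Y) (fW : preserves f (set_val @^-1` W))
    (gW : preserves g (set_val @^-1` W))
    (gfW : preserves (homeo_comp g f) (set_val @^-1` W)) :
  restr_homeo sWY gfW = homeo_comp (restr_homeo sWY gW) (restr_homeo sWY fW).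
Proof.
apply: homeo_ext => w; apply: set_val_inj.
by rewrite /= !val_restr_fun /= (subfun_restr fW).
Qed.

Lemma restr_homeo_inv (f : homeo Y Y) (fW : preserves f (set_val @^-1` W))
    (fVW : preserves (homeo_inv f) (set_val @^-1` W)) :
  restr_homeo sWY fVW = homeo_inv (restr_homeo sWY fW).
Proof. by apply: homeo_ext => w; apply: set_val_inj; rewrite /= !val_restr_fun. Qed.

Lemma preserves_id (B : set T) : preserves (homeo_id T) B.
Proof. by apply/preservesP. Qed.

End Homeos.

Lemma restr_homeo_id (T : topologicalType) (Y W : set T) (sWY : W `<=` Y)
    (iW : preserves (homeo_id Y) (set_val @^-1` W)) :
  restr_homeo sWY iW = homeo_id W.
Proof.
by apply: homeo_ext => w; apply: set_val_inj; rewrite /= val_restr_fun /= subfun_val.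
Qed.

Lemma homeo_restrict (T : topologicalType) (h : homeo T T) (Y : set T) :
  preserves h Y -> exists hY : homeo Y Y,
    forall y, set_val (hY y) = h (set_val y).
Proof.
have sub (k : homeo T T) : preserves k Y -> exists2 kY : Y -> Y,
    continuous kY & forall y, set_val (kY y) = k (set_val y).
  move=> kY; have Yk (y : Y) : Y (k (set_val y)).
    by move/preservesP : kY => /(_ (set_val y))[+ _]; apply; exact: set_valP.
  have ex (y : Y) : exists z : Y, set_val z = k (set_val y).
    exact: set_val_ex.
  have [l lE] := choice ex.
  exists l => //.
  apply: continuous_comp_initial.
  rewrite (_ : _ \o _ = k \o set_val); last exact/funext.
  move=> y; apply: continuous_comp; first exact: set_val_cts.
  exact: homeo_cts.
move=> hY; have [f cf fE] := sub h hY.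
have [g cg gE] := sub (homeo_inv h) (preserves_inv hY).
have fK : cancel f g by move=> y; apply: set_val_inj; rewrite gE fE /= homeo_funK.
have gK : cancel g f by move=> y; apply: set_val_inj; rewrite fE gE /= homeo_invK.
by exists (Homeo cf cg fK gK).
Qed.

(** The inverses must agree as well: maps that agree on the overlap may still send a point of [U]
    outside [V] and a point of [V] outside [U] to the same place, and the glued map is then not
    injective. *)
Lemma glue_homeo (T : topologicalType) (U V : set T) (f : homeo U U)
    (g : homeo V V) : open U -> open V -> U `|` V = setT ->
  (forall u v, set_val u = set_val v -> set_val (f u) = set_val (g v)) ->
  (forall u v, set_val u = set_val v ->
    set_val (homeo_inv f u) = set_val (homeo_inv g v)) ->
  exists h : homeo T T, [/\ forall u, set_val (f u) = h (set_val u),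
    forall v, set_val (g v) = h (set_val v),
    forall u, set_val (homeo_inv f u) = homeo_inv h (set_val u) &
    forall v, set_val (homeo_inv g v) = homeo_inv h (set_val v)].
Proof.
move=> oU oV UV.
have pts (x : T) (P : T -> Prop) : (forall u : U, P (set_val u)) ->
    (forall v : V, P (set_val v)) -> P x.
  move=> PU PV; have [Ux|Vx] : (U `|` V) x by rewrite UV.
    by have [u <-] := @set_val_ex _ U _ Ux.
  by have [v <-] := @set_val_ex _ V _ Vx.
have glue1 (k : homeo U U) (l : homeo V V) :
    (forall u v, set_val u = set_val v -> set_val (k u) = set_val (l v)) ->
    exists h : T -> T, [/\ continuous h, forall u, set_val (k u) = h (set_val u) &
      forall v, set_val (l v) = h (set_val v)].
  move=> kl; have /choice[h hP] x : exists y,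
      (forall u, set_val u = x -> y = set_val (k u)) /\
      (forall v, set_val v = x -> y = set_val (l v)).
    elim/pts : x => [u|v].
      exists (set_val (k u)); split=> [u' /set_val_inj->//|v vu].
      exact: kl.
    exists (set_val (l v)); split=> [u uv|v' /set_val_inj->//].
    by rewrite (kl _ _ uv).
  have hk u : set_val (k u) = h (set_val u) by have [/(_ u) -> ] := hP (set_val u).
  have hl v : set_val (l v) = h (set_val v) by have [_ /(_ v) -> ] := hP (set_val v).
  have cts (Y : set T) (m : homeo Y Y) : open Y ->
      (forall y, set_val (m y) = h (set_val y)) ->
      forall y : Y, {for set_val y, continuous h}.
    move=> oY mE y B; rewrite /= -mE => Bm.
    have : nbhs y ((set_val \o m) @^-1` B).
      by apply: continuous_comp Bm; [exact: homeo_cts|exact: set_val_cts].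
    rewrite nbhsE => -[N [oN Ny] NB]; rewrite nbhsE; exists (set_val @` N).
      by split; [exact: set_val_open|exists y].
    by move=> _ [z Nz <-]; rewrite /= -mE; exact: NB.
  exists h; split=> // x.
  by elim/pts : x => y; [exact: cts oU hk y|exact: cts oV hl y].
move=> /glue1[h [ch hf hg]] /glue1[k [ck kf kg]].
have hK : cancel h k.
  by elim/pts => y; [rewrite -hf -kf /= homeo_funK|rewrite -hg -kg /= homeo_funK].
have kK : cancel k h.
  by elim/pts => y; [rewrite -kf -hf /= homeo_invK|rewrite -kg -hg /= homeo_invK].
by exists (Homeo ch ck hK kK).
Qed.

Lemma glue_preserves (T : topologicalType) (Y : set T) (f : homeo Y Y)
    (h : homeo T T) : (forall y, set_val (f y) = h (set_val y)) ->
  (forall y, set_val (homeo_inv f y) = homeo_inv h (set_val y)) ->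
  preserves h Y.
Proof.
move=> fh fVh; apply/preservesP => x; split=> Yx.
  by have [y <-] := @set_val_ex _ Y _ Yx; rewrite -fh; exact: set_valP.
have [y yx] := @set_val_ex _ Y _ Yx.
rewrite -(homeo_funK h x) -yx -[homeo_invfun h]/(homeo_fun (homeo_inv h)) -fVh.
exact: set_valP.
Qed.

(** The maximal atlas consists of all charts compatible with [A]. Two of them are compatible with
    each other because, near each point, their transition passes through a chart of [A]. *)
Lemma atlas_structure (R : realType) (r : option nat) (T : topologicalType)
    (A : charts R T) : is_atlas r A ->
  exists S, is_structure r S /\ charts_sub A S.
Proof.
move=> [chA cvA trA].
pose S : charts R T := fun n => [set c | is_chart c /\ forall m d, A m d ->
  Cr_expr r (c.1 `&` d.1) c.2 d.2 /\ Cr_expr r (d.1 `&` c.1) d.2 c.2].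
have AS : charts_sub A S.
  by move=> n c Ac; split=> [|m d Ad]; [exact: chA|split; exact: trA].
exists S; split=> //; split.
  split=> [n c []//|x|m n c c' [chc Sc] [_ Sc']].
    by have [n [c [Ac cx]]] := cvA x; exists n, c; split=> //; exact: AS.
  apply: (Cr_expr_local chc (@subIsetl _ _ _)) => x [cx c'x].
  have [p [d [Ad dx]]] := cvA x; exists d.1; split=> //.
    exact: is_chart_open (chA _ _ Ad).
  have [cd _] := Sc _ _ Ad; have [_ dc'] := Sc' _ _ Ad.
  apply: (@Cr_expr_trans _ _ _ _ _ _ _ _ d.2).
    by apply: sub_Cr_expr cd => z [[]].
  by apply: sub_Cr_expr dc' => z [[]].
move=> B [chB _ trB] SB n c Bc; split=> [|m d Ad]; first exact: chB.
by have Bd := SB _ _ (AS _ _ Ad); split; exact: trB.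
Qed.

Lemma pull_chart_self (R : realType) (r : option nat) (T : topologicalType)
    (Y : set T) (A : charts R Y) (f : homeo Y Y) m n (c : prechart R Y m)
    (d : prechart R Y n) : is_atlas r A -> A m c -> A n d ->
  Cr_expr r ((pull_chart f c).1 `&` (pull_chart f d).1)
    (pull_chart f c).2 (pull_chart f d).2.
Proof.
move=> [_ _ trA] Ac Ad; pose D := f @^-1` (c.1 `&` d.1).
have DE : (pull_chart f c).1 `&` (pull_chart f d).1 `<=` (set_val : Y -> T) @` D.
  move=> _ [[y cy <-] [z dz /set_val_inj zy]]; exists y => //.
  by split=> //; rewrite -zy.
apply: (sub_Cr_expr DE); apply: Cr_expr_push.
have := Cr_expr_pull (g := f) (D := D) (fun y => id) (trA _ _ _ _ Ac Ad).
by apply: Cr_expr_eq => // y _; symmetry; exact: valL_val.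
Qed.

(** With [p], [q] the restrictions to W of phi, psi, and similarly for the primed maps, the
    conclusion is the agreement on W of phi'^-1 a phi and psi'^-1 b psi that gluing requires. *)
Lemma homeo_comp_cancel (T : topologicalType) (p p' q q' a b : homeo T T) :
  homeo_comp q' (homeo_inv p') =
    homeo_comp b (homeo_comp (homeo_comp q (homeo_inv p)) (homeo_inv a)) ->
  homeo_comp (homeo_inv p') (homeo_comp a p) =
    homeo_comp (homeo_inv q') (homeo_comp b q).
Proof.
move=> E; apply: homeo_ext => x /=.
have := congr1 (fun f : homeo T T => f (a (p x))) E.
by rewrite /= !homeo_funK => <-; rewrite homeo_funK.
Qed.

(** [k] stands for the restriction to W of a diffeomorphism between two induced structures; it
    cancels between the conjugates b = q' k q^-1 and a = p' k p^-1. *)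
Lemma homeo_comp_conj (T : topologicalType) (p p' q q' k : homeo T T) :
  homeo_comp q' (homeo_inv p') =
  homeo_comp (homeo_comp (homeo_comp q' k) (homeo_inv q))
    (homeo_comp (homeo_comp q (homeo_inv p))
      (homeo_inv (homeo_comp (homeo_comp p' k) (homeo_inv p)))).
Proof. by apply: homeo_ext => x; rewrite /= !homeo_funK homeo_invK. Qed.

(** * Induced atlases, double cosets and the diffeomorphisms between induced structures *)

Section Atlases.
Variables (R : realType) (r : option nat) (M : topologicalType).
Variables (At : charts R M) (hAt : is_atlas r At).
Variables (U V : set M) (oU : open U) (oV : open V) (hUV : U `|` V = setT).
Local Notation W := (U `&` V).
Local Notation sU := (@subIsetl M U V).
Local Notation sV := (@subIsetr M U V).
Local Notation AtU := (restr_charts At U).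
Local Notation AtV := (restr_charts At V).
Local Notation AtW := (restr_charts At W).

Local Notation dc := (@double_coset R r M At U V).

Let aU : is_atlas r AtU. Proof. exact: restr_atlas. Qed.
Let aV : is_atlas r AtV. Proof. exact: restr_atlas. Qed.

Lemma pull_chart_val (Y : set M) (sWY : W `<=` Y) (f : homeo Y Y)
    (fW : preserves f (set_val @^-1` W)) n (c : prechart R M n) (w : W) :
  (pull_chart f (set_val @^-1` c.1, c.2 \o set_val)).2 (set_val w) =
  c.2 (set_val (restr_homeo sWY fW w)).
Proof.
rewrite -(subfun_val sWY w); apply: (etrans (valL_val _ _)).
by rewrite /= -(subfun_restr sWY fW) subfun_val.
Qed.

Lemma pull_chart_dom (Y : set M) (sWY : W `<=` Y) (f : homeo Y Y)
    (fW : preserves f (set_val @^-1` W)) n (c : prechart R M n) (w : W) :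
  (pull_chart f (set_val @^-1` c.1, c.2 \o set_val)).1 (set_val w) ->
  c.1 (set_val (restr_homeo sWY fW w)).
Proof.
move=> [y cy yw]; have -> : set_val (restr_homeo sWY fW w) = set_val (f y).
  rewrite -(subfun_val sWY) subfun_restr; congr (set_val (f _)).
  by apply: set_val_inj; rewrite yw subfun_val.
exact: cy.
Qed.

(** On W the pulled-back charts are [c] after [g] and [d] after [g'], so their compatibility is the
    smoothness of g' g^-1 read in [c] and [d]. General [Y] and [Y'] cover both orders of U and V,
    the second through the inverse transition map. *)
Lemma pull_chart_cross (Y Y' : set M) (sWY : W `<=` Y) (sWY' : W `<=` Y')
    (f : homeo Y Y) (f' : homeo Y' Y')
    (fW : preserves f (set_val @^-1` W)) (fW' : preserves f' (set_val @^-1` W))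
    m n (c : prechart R M m) (d : prechart R M n) : Y `&` Y' `<=` W ->
  Cr_map r AtW AtW
    (homeo_comp (restr_homeo sWY' fW') (homeo_inv (restr_homeo sWY fW))) ->
  At c -> At d ->
  let c1 := pull_chart f (set_val @^-1` c.1, c.2 \o set_val) in
  let d1 := pull_chart f' (set_val @^-1` d.1, d.2 \o set_val) in
  Cr_expr r (c1.1 `&` d1.1) c1.2 d1.2.
Proof.
move=> YW [_ Cg] Ac Ad c1 d1.
set g := restr_homeo sWY fW in Cg *; set g' := restr_homeo sWY' fW' in Cg *.
pose D : set W := [set w | c.1 (set_val (g w)) /\ d.1 (set_val (g' w))].
have DE : c1.1 `&` d1.1 `<=` (set_val : W -> M) @` D.
  move=> x [cx dx]; have [|w wx] := @set_val_ex _ W x.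
    apply: YW; have [[y _ <-] [z _ zy]] := (cx, dx).
    by split; [|rewrite -zy]; exact: set_valP.
  rewrite -wx in cx dx *; exists w => //.
  by split; [exact: pull_chart_dom cx|exact: pull_chart_dom dx].
apply: (sub_Cr_expr DE); apply: Cr_expr_push.
have := Cg m n _ _ (ex_intro2 _ _ c Ac erefl) (ex_intro2 _ _ d Ad erefl).
move=> /(Cr_expr_pull (g := g) (D := D)) H; apply: Cr_expr_eq (H _) => //.
- by move=> w _; symmetry; exact: pull_chart_val.
- move=> w _; transitivity (d.2 (set_val (g' (homeo_invfun g (g w))))) => //.
  by rewrite homeo_funK; symmetry; exact: pull_chart_val.
- move=> w [cw dw]; split=> //.
  by rewrite -[w](homeo_funK g) in dw.
Qed.

Lemma induced_atlasP (A : UV_atlas r At U V) : is_atlas r (induced_atlas A).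
Proof.
split.
- by move=> n _ [[c Ac <-]|[c Ac <-]]; apply: pull_chart_is_chart => //;
    [have [chU _ _] := aU; exact: chU|have [chV _ _] := aV; exact: chV].
- move=> x; have [Ux|Vx] : (U `|` V) x by rewrite hUV.
    have [u ux] := @set_val_ex _ U _ Ux.
    have [_ cvU _] := aU; have [n [c [Ac cu]]] := cvU (uv_phi A u).
    exists n, (pull_chart (uv_phi A) c); split; first by left; exists c.
    by exists u.
  have [v vx] := @set_val_ex _ V _ Vx.
  have [_ cvV _] := aV; have [n [c [Ac cv]]] := cvV (uv_psi A v).
  exists n, (pull_chart (uv_psi A) c); split; first by right; exists c.
  by exists v.
move=> m n _ _ [[c Ac <-]|[c Ac <-]] [[d Ad <-]|[d Ad <-]].
- exact: pull_chart_self aU Ac Ad.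
- move: Ac Ad => [c' Ac' <-] [d' Ad' <-].
  apply: (pull_chart_cross (sWY := sU) (sWY' := sV)
    (fW := uv_phiW A) (fW' := uv_psiW A)) => //.
  exact: (uv_diffeo A).1.
- move: Ac Ad => [c' Ac' <-] [d' Ad' <-].
  apply: (pull_chart_cross (sWY := sV) (sWY' := sU)
    (fW := uv_psiW A) (fW' := uv_phiW A)) => //; first by rewrite setIC.
  exact: (uv_diffeo A).2.
- exact: pull_chart_self aV Ac Ad.
Qed.

Lemma extendable_id (Y : set M) (sWY : W `<=` Y) : open Y ->
  extendable r At sWY (homeo_id W).
Proof.
move=> oY; exists (homeo_id Y), (preserves_id _); rewrite restr_homeo_id.
by split=> //; apply: Cr_diffeo_id; exact: restr_atlas.
Qed.

Lemma extendable_comp (Y : set M) (sWY : W `<=` Y) f g : open Y ->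
  extendable r At sWY f -> extendable r At sWY g ->
  extendable r At sWY (homeo_comp g f).
Proof.
move=> oY [a [aW' [da ->]]] [b [bW [db ->]]].
have aY := restr_atlas oY hAt.
exists (homeo_comp b a), (preserves_comp aW' bW); split.
  exact: Cr_diffeo_comp da db.
by symmetry; exact: restr_homeo_comp.
Qed.

Lemma extendable_inv (Y : set M) (sWY : W `<=` Y) f :
  extendable r At sWY f -> extendable r At sWY (homeo_inv f).
Proof.
move=> [a [aW' [da ->]]]; exists (homeo_inv a), (preserves_inv aW'); split.
  exact: Cr_diffeo_inv.
by symmetry; exact: restr_homeo_inv.
Qed.

Lemma double_coset_refl g : dc g g.
Proof.
exists (homeo_id W), (homeo_id W); split; [exact: extendable_id..|].
exact: homeo_ext.
Qed.

Lemma double_coset_eq g g' : dc g g' ->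
  dc g' = dc g.
Proof.
move=> [a [b [ea eb ->]]]; apply/seteqP; split=> _ [c [d [ec ed ->]]].
  exists (homeo_comp c a), (homeo_comp d b); split; [exact: extendable_comp..|].
  exact: homeo_ext.
exists (homeo_comp c (homeo_inv a)), (homeo_comp d (homeo_inv b)); split.
- by apply: extendable_comp => //; exact: extendable_inv.
- by apply: extendable_comp => //; exact: extendable_inv.
- by apply: homeo_ext => w /=; rewrite !homeo_funK.
Qed.

Lemma UV_charts_diffeo (A : UV_atlas r At U V) (S : charts R M) :
  is_atlas r S -> charts_sub (induced_atlas A) S ->
  Cr_diffeo r (restr_charts S U) AtU (uv_phi A) /\
  Cr_diffeo r (restr_charts S V) AtV (uv_psi A).
Proof.
move=> aS QS; split; apply: pull_chart_diffeo => // n c Ac; apply: QS.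
  by left; exists c.
by right; exists c.
Qed.

Lemma diffeo_double_coset (A A' : UV_atlas r At U V) (S S' : charts R M)
    (h : homeo M M) : is_atlas r S -> is_atlas r S' ->
  charts_sub (induced_atlas A) S -> charts_sub (induced_atlas A') S' ->
  preserves h U -> preserves h V -> Cr_diffeo r S S' h ->
  dc (transition A) (transition A').
Proof.
move=> aS aS' QS QS' hU hV [h1 h2].
have [k kE] := homeo_restrict hU; have [l lE] := homeo_restrict hV.
have kVE u : set_val (homeo_inv k u) = homeo_inv h (set_val u).
  by rewrite -{2}[u](homeo_invK k) kE /= homeo_funK.
have lVE u : set_val (homeo_inv l u) = homeo_inv h (set_val u).
  by rewrite -{2}[u](homeo_invK l) lE /= homeo_funK.
have /preservesP hUP := hU; have /preservesP hVP := hV.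
have hW x : W x <-> W (h x).
  by split=> -[Ux Vx]; split;
    [exact: (hUP x).1|exact: (hVP x).1|exact: (hUP x).2|exact: (hVP x).2].
have kW : preserves k (set_val @^-1` W).
  by apply/preservesP => u; rewrite /preimage /= kE; exact: hW.
have lW : preserves l (set_val @^-1` W).
  by apply/preservesP => u; rewrite /preimage /= lE; exact: hW.
have [dphi dpsi] := UV_charts_diffeo aS QS.
have [dphi' dpsi'] := UV_charts_diffeo aS' QS'.
have aSU := restr_atlas oU aS; have aSV := restr_atlas oV aS.
have aSU' := restr_atlas oU aS'; have aSV' := restr_atlas oV aS'.
have dk : Cr_diffeo r (restr_charts S U) (restr_charts S' U) k.
  by split; [exact: Cr_map_restr (homeo_cts k) kE h1|
    exact: Cr_map_restr (homeo_invcts k) kVE h2].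
have dl : Cr_diffeo r (restr_charts S V) (restr_charts S' V) l.
  by split; [exact: Cr_map_restr (homeo_cts l) lE h1|
    exact: Cr_map_restr (homeo_invcts l) lVE h2].
(* [k] and [l] restrict the same [h], hence coincide on W; this common map is what [homeo_comp_conj]
   cancels. *)
have kl : restr_homeo sU kW = restr_homeo sV lW.
  apply: homeo_ext => w; apply: set_val_inj.
  by rewrite /= !val_restr_fun kE lE !subfun_val.
have phiVW := preserves_inv (uv_phiW A); have psiVW := preserves_inv (uv_psiW A).
pose a := homeo_comp (homeo_comp (uv_phi A') k) (homeo_inv (uv_phi A)).
pose b := homeo_comp (homeo_comp (uv_psi A') l) (homeo_inv (uv_psi A)).
have aW' := preserves_comp phiVW (preserves_comp kW (uv_phiW A')).
have bW := preserves_comp psiVW (preserves_comp lW (uv_psiW A')).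
exists (restr_homeo sU aW'), (restr_homeo sV bW); split.
- exists a, aW'; split=> //.
  apply: (Cr_diffeo_comp aU aSU aU (Cr_diffeo_inv dphi)).
  exact: Cr_diffeo_comp dk dphi'.
- exists b, bW; split=> //.
  apply: (Cr_diffeo_comp aV aSV aV (Cr_diffeo_inv dpsi)).
  exact: Cr_diffeo_comp dl dpsi'.
rewrite (restr_homeo_comp _ phiVW (preserves_comp kW (uv_phiW A'))).
rewrite (restr_homeo_comp _ psiVW (preserves_comp lW (uv_psiW A'))).
rewrite (restr_homeo_comp _ kW (uv_phiW A')) (restr_homeo_comp _ lW (uv_psiW A')).
rewrite (restr_homeo_inv _ (uv_phiW A)) (restr_homeo_inv _ (uv_psiW A)) kl.
exact: homeo_comp_conj.
Qed.

Lemma double_coset_diffeo (A A' : UV_atlas r At U V) (S S' : charts R M) :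
  is_atlas r S -> is_atlas r S' ->
  charts_sub (induced_atlas A) S -> charts_sub (induced_atlas A') S' ->
  dc (transition A) (transition A') ->
  exists h : homeo M M,
    [/\ preserves h U, preserves h V & Cr_diffeo r S S' h].
Proof.
move=> aS aS' QS QS' [_ [_ [[a [aW' [da ->]]] [b [bW [db ->]]] trE]]].
have [dphi dpsi] := UV_charts_diffeo aS QS.
have [dphi' dpsi'] := UV_charts_diffeo aS' QS'.
have aSU := restr_atlas oU aS; have aSV := restr_atlas oV aS.
have aSU' := restr_atlas oU aS'; have aSV' := restr_atlas oV aS'.
have phiVW := preserves_inv (uv_phiW A'); have psiVW := preserves_inv (uv_psiW A').
pose k := homeo_comp (homeo_inv (uv_phi A')) (homeo_comp a (uv_phi A)).
pose l := homeo_comp (homeo_inv (uv_psi A')) (homeo_comp b (uv_psi A)).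
have kW : preserves k (set_val @^-1` W).
  exact: preserves_comp (preserves_comp (uv_phiW A) aW') phiVW.
have lW : preserves l (set_val @^-1` W).
  exact: preserves_comp (preserves_comp (uv_psiW A) bW) psiVW.
have dk : Cr_diffeo r (restr_charts S U) (restr_charts S' U) k.
  apply: (Cr_diffeo_comp aSU aU aSU' _ (Cr_diffeo_inv dphi')).
  exact: Cr_diffeo_comp dphi da.
have dl : Cr_diffeo r (restr_charts S V) (restr_charts S' V) l.
  apply: (Cr_diffeo_comp aSV aV aSV' _ (Cr_diffeo_inv dpsi')).
  exact: Cr_diffeo_comp dpsi db.
have kl : restr_homeo sU kW = restr_homeo sV lW.
  rewrite (restr_homeo_comp _ (preserves_comp (uv_phiW A) aW') phiVW).
  rewrite (restr_homeo_comp _ (preserves_comp (uv_psiW A) bW) psiVW).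
  rewrite (restr_homeo_comp _ (uv_phiW A) aW') (restr_homeo_comp _ (uv_psiW A) bW).
  rewrite (restr_homeo_inv _ (uv_phiW A')) (restr_homeo_inv _ (uv_psiW A')).
  exact: homeo_comp_cancel trE.
have agree (f : homeo U U) (g : homeo V V) (fW : preserves f (set_val @^-1` W))
    (gW : preserves g (set_val @^-1` W)) : restr_homeo sU fW = restr_homeo sV gW ->
    forall u v, set_val u = set_val v -> set_val (f u) = set_val (g v).
  move=> fg u v uv; have [|w wu] := @set_val_ex _ W (set_val u).
    by split; [|rewrite uv]; exact: set_valP.
  have -> : u = subfun sU w by apply: set_val_inj; rewrite subfun_val.
  have -> : v = subfun sV w by apply: set_val_inj; rewrite subfun_val wu.
  by rewrite -(subfun_restr sU fW) -(subfun_restr sV gW) !subfun_val fg.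
(* Restriction to W commutes with inversion, which supplies the second agreement condition of
   [glue_homeo]. *)
have kVlV : restr_homeo sU (preserves_inv kW) = restr_homeo sV (preserves_inv lW).
  by rewrite (restr_homeo_inv _ kW) (restr_homeo_inv _ lW) kl.
have [h [kh lh kVh lVh]] :=
  glue_homeo oU oV hUV (agree _ _ _ _ kl) (agree _ _ _ _ kVlV).
exists h; split.
- exact: glue_preserves kh kVh.
- exact: glue_preserves lh lVh.
split.
  apply: (Cr_map_glue aS oU oV hUV _ kh lh dk.1 dl.1); exact: homeo_cts.
apply: (Cr_map_glue aS' oU oV hUV _ kVh lVh dk.2 dl.2); exact: homeo_invcts.
Qed.

End Atlases.

Theorem theorem4p2p1 (R : realType) (r : option nat) (hr : r <> Some 0%N)
    (M : topologicalType) (At : charts R M) (hAt : is_atlas r At)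
    (U V : set M) (oU : open U) (oV : open V) (hUV : U `|` V = setT) :
  exists mu : set (charts R M) -> set (homeo (U `&` V) (U `&` V)),
    [/\ set_fun (UV_quotient r At U V) (double_cosets r At U V) mu,
        forall (A : UV_atlas r At U V) (S : charts R M),
          is_structure r S -> charts_sub (induced_atlas A) S ->
          mu (UV_class r At U V S) = double_coset r At (transition A),
        set_inj (UV_quotient r At U V) mu &
        set_bij (UV_quotient r At U V) (double_cosets r At U V) mu <->
        (forall g, diffeos r At U V g ->
           exists A : UV_atlas r At U V, transition A = g)].
Proof.
(* [mu] collects the double cosets coming from all representatives of a class, which avoids choosing
   one; [muE] shows that they are all equal. *)
pose mu (X : set (charts R M)) : set (homeo (U `&` V) (U `&` V)) :=
  [set g | exists S (A : UV_atlas r At U V), [/\ X = UV_class r At U V S,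
    is_structure r S, charts_sub (induced_atlas A) S &
    double_coset r At (transition A) g]].
have class_refl S : UV_structures r At U V S -> UV_class r At U V S S.
  move=> SS; split=> //; exists (homeo_id M).
  by split; [exact: preserves_id..|exact: Cr_diffeo_id SS.1.1].
have muE (A : UV_atlas r At U V) S : is_structure r S ->
    charts_sub (induced_atlas A) S ->
    mu (UV_class r At U V S) = double_coset r At (transition A).
  move=> sS AS; apply/seteqP; split=> [g [S' [A' [SS' sS' AS' gA']]]|g gA].
    have : UV_class r At U V S' S' by apply: class_refl; split=> //; exists A'.
    rewrite -SS' => -[_ [h [hU hV dh]]].
    have AA' := diffeo_double_coset hAt oU oV sS.1 sS'.1 AS AS' hU hV dh.
    by rewrite -(double_coset_eq hAt oU oV AA').
  by exists S, A.
have mu_inj : set_inj (UV_quotient r At U V) mu.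
  move=> _ _ /set_mem[S1 [s1 [A1 AS1]] <-] /set_mem[S2 [s2 [A2 AS2]] <-].
  rewrite (muE _ _ s1 AS1) (muE _ _ s2 AS2) => A12.
  have : double_coset r At (transition A1) (transition A2).
    by rewrite A12; exact: double_coset_refl.
  move=> /(double_coset_diffeo hAt oU oV hUV s1.1 s2.1 AS1 AS2).
  move=> [h [hU hV dh]]; have dh' := Cr_diffeo_inv dh.
  apply/seteqP; split=> S [SS [k [kU kV dk]]]; split=> //.
    exists (homeo_comp k (homeo_inv h)); split.
    - exact: preserves_comp (preserves_inv hU) kU.
    - exact: preserves_comp (preserves_inv hV) kV.
    - exact: (Cr_diffeo_comp s2.1 s1.1 SS.1.1 dh' dk).
  exists (homeo_comp k h); split.
  - exact: preserves_comp hU kU.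
  - exact: preserves_comp hV kV.
  - exact: (Cr_diffeo_comp s1.1 s2.1 SS.1.1 dh dk).
have mu_fun : set_fun (UV_quotient r At U V) (double_cosets r At U V) mu.
  move=> _ [S [sS [A AS]] <-]; rewrite (muE _ _ sS AS).
  by exists (transition A) => //; exact: uv_diffeo.
exists mu; split=> //; split=> [[_ _ surj] g dg|tr].
  have [_ [S [sS [A AS]] <-]] := surj _ (imageP (double_coset r At) dg).
  rewrite (muE _ _ sS AS) => gA.
  have := double_coset_refl hAt oU oV g; rewrite -gA.
  move=> [_ [_ [[a [aW [da ->]]] [b [bW [db ->]]] gE]]].
  (* Membership of [g] in the double coset of [A] writes it as b g_A a^-1, the transition map
     obtained by replacing phi with a phi and psi with b psi. *)
  have E : transition_homeo (preserves_comp (uv_phiW A) aW)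
      (preserves_comp (uv_psiW A) bW) = g.
    rewrite gE /transition_homeo (restr_homeo_comp _ (uv_phiW A) aW).
    by rewrite (restr_homeo_comp _ (uv_psiW A) bW); exact: homeo_ext.
  have dE := dg; rewrite -E in dE.
  by exists (UVAtlas dE).
split=> // _ [g dg <-]; have [A <-] := tr g dg.
have [S [sS AS]] := atlas_structure (induced_atlasP hAt oU oV hUV A).
exists (UV_class r At U V S); last exact: muE.
by exists S => //; split=> //; exists A.
Qed.
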